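(* The profile random vector of the Hüsler–Reiss model parametrized by $\Gamma$ is $$\mathbf{U}\sim N(\boldsymbol{\mu},\Sigma),$$ where $$\Sigma:=-\frac12\left(I-\frac{\mathbf{1}\mathbf{1}^T}{d}\right)\Gamma\left(I-\frac{\mathbf{1}\mathbf{1}^T}{d}\right)$$ and $$\boldsymbol{\mu}:=-\frac12\left\{\mathrm{diag}(\Sigma)-\overline{\mathrm{diag}(\Sigma)}\cdot\mathbf{1}\right\}.$$
   Context: Notation: $\mathbf{1}=(1,\ldots,1)\in\mathbb{R}^d$, $\mathbf{0}=(0,\ldots,0)$; $I$ is the $d\times d$ identity matrix; $\bar x=d^{-1}\sum_{k=1}^d x_k$ for $\mathbf{x}=(x_1,\ldots,x_d)$; $\mathbf{1}^\perp=\{\mathbf{v}\in\mathbb{R}^d:\mathbf{v}^T\mathbf{1}=0\}$; $\mathrm{diag}(\Sigma)=(\Sigma_{11},\ldots,\Sigma_{dd})$ and $\overline{\mathrm{diag}(\Sigma)}$ is its component mean. Operations and inequalities between vectors (including maxima of several vectors and the minimum $\wedge$) are componentwise. $N(\boldsymbol\mu,\Sigma)$ with singular $\Sigma$ is the degenerate Gaussian law with that mean and covariance. Hüsler–Reiss model parametrized by $\Gamma$: consider a Gaussian triangular array $\mathbf{X}^{(n)}_i\sim N(\mathbf{0},\Sigma^{(n)})$, $i=1,\ldots,n$ (independent for each $n$), where $\Sigma^{(n)}_{kk}=1$, $k=1,\ldots,d$, and the off-diagonal elements of $\Sigma^{(n)}$ converge to 1 such that $$\log(n)\cdot(\mathbf{1}\mathbf{1}^T-\Sigma^{(n)})\to\Gamma=(\Gamma_{ij})_{1\le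 i,j\le d},\qquad n\to\infty.$$ The matrix $\Gamma$ satisfies $\Gamma_{ij}=E(W_i-W_j)^2$ for some centered multivariate Gaussian random vector $\mathbf{W}=(W_1,\ldots,W_d)$ and is called the variogram of $\mathbf{W}$; no rank condition is imposed. Let $\phi$ be the standard normal density and $b_n$ the solution of $b_n=n\,\phi(b_n)$. Then $$\lim_{n\to\infty}\mathrm{pr}\left\{b_n\cdot\left(\max_{i=1,\ldots,n}\mathbf{X}^{(n)}_i-b_n\cdot\mathbf{1}\right)\le\mathbf{x}\right\}=G_\Gamma(\mathbf{x}),$$ where $G_\Gamma$ has standard Gumbel marginals and is the generalized multivariate extreme value distribution associated with the Hüsler–Reiss model parametrized by $\Gamma$. The standardized multivariate generalized Pareto distribution $\mathbf{Z}$ of the model is the random vector with distribution function $\mathrm{pr}(\mathbf{Z}\le\mathbf{z})=\{\ln G_\Gamma(\mathbf{z}\wedge\mathbf{0})-\ln G_\Gamma(\mathbf{z})\}/\ln G_\Gamma(\mathbf{0})$. Profile random vector: for a standardized multivariate generalized Pareto distribution $\mathbf{Z}$ with asymptotically dependent components (i.e. $\mathrm{pr}(Z_k>-\infty)=1$ for all $k$), put $\mathbf{Z}^*\overset{d}{=}\mathbf{Z}\,|\,\{\mathbf{Z}^T\mathbf{1}\ge0\}$. It is known that $\mathbf{Z}^*\overset{d}{=}E'\cdot\mathbf{1}+\mathbf{U}$ with $\mathbf{U}\in\mathbf{1}^\perp$ and $E'$ a unit exponential variable independent of $\mathbf{U}$; the random vector $\mathbf{U}\overset{d}{=}\mathbf{Z}^*-\bar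 Z^*\cdot\mathbf{1}$ (determined in law) is the profile random vector of the model.
   Formalization: In the Gaussian array defining the model, log(n)(11^T − Σ^(n)) is taken to converge to Γ/4 instead of Γ, so that Γ is the variogram of the limit; with limit Γ the profile covariance would be 4Σ and the claim false for every Γ ≠ 0. *)

(* Defs.v *)
From HB Require Import structures.
From mathcomp Require Import all_boot all_order all_algebra.
From mathcomp Require Import all_classical all_reals all_analysis.

Set Implicit Arguments.
Unset Strict Implicit.
Unset Printing Implicit Defensive.

Import Order.TTheory GRing.Theory Num.Theory.
Import numFieldNormedType.Exports.

Local Open Scope classical_set_scope.
Local Open Scope ring_scope.

(* Random vectors take values in [d.-tuple R], whose library sigma-algebra is
   generated by the coordinates (hence is the Borel one); deterministic vectors
   are columns ['cV[R]_d].  The two functions below translate. *)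
Definition col_of_tuple (R : realType) (d : nat) (t : d.-tuple R) : 'cV[R]_d :=
  \col_k tnth t k.

Definition tuple_of_col (R : realType) (d : nat) (v : 'cV[R]_d) : d.-tuple R :=
  [tuple v k 0 | k < d].

Definition ones (R : realType) (d : nat) : 'cV[R]_d := const_mx 1.

Definition vmean (R : realType) (d : nat) (v : 'cV[R]_d) : R :=
  d%:R^-1 * \sum_k v k 0.

Definition mdiag (R : realType) (d : nat) (S : 'M[R]_d) : 'cV[R]_d :=
  \col_k S k k.

Definition le_vec (R : realType) (d : nat) (v w : 'cV[R]_d) : Prop :=
  forall k, v k 0 <= w k 0.

(* The rows are allowed to be [setT], so this is the product rule over every
   finite subfamily. *)
Definition mutually_independent (R : realType) (dO dT : measure_display)
    (Om : measurableType dO) (T : measurableType dT) (P : probability Om R)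
    (n : nat) (X : 'I_n -> {RV P >-> T}) : Prop :=
  forall A : 'I_n -> set T, (forall i, measurable (A i)) ->
    P [set w | forall i, A i (X i w)] = (\prod_(i < n) P (X i @^-1` A i))%E.

(* N(mu, S), possibly degenerate: the law of mu + A Y, with A A^T = S and Y a
   vector of independent standard normal variables. *)
Definition gaussian (R : realType) (d : nat) (mu : 'cV[R]_d) (S : 'M[R]_d)
    (dO : measure_display) (Om : measurableType dO) (P : probability Om R)
    (X : {RV P >-> d.-tuple R}) : Prop :=
  exists A : 'M[R]_d, A *m A^T = S /\
  exists (dY : measure_display) (OmY : measurableType dY)
         (Q : probability OmY R) (Y : 'I_d -> {RV Q >-> R}),
    [/\ mutually_independent Y,
        forall i (B : set R), measurable B ->
          distribution Q (Y i) B = normal_prob 0 1 B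
      & forall B : set (d.-tuple R), measurable B ->
          distribution P X B =
          Q [set w | B (tuple_of_col (mu + A *m \col_j Y j w))] ].

Definition is_variogram (R : realType) (d : nat) (Gamma : 'M[R]_d) : Prop :=
  exists (dO : measure_display) (Om : measurableType dO)
         (P : probability Om R) (W : {RV P >-> d.-tuple R}) (C : 'M[R]_d),
    gaussian 0 C W /\
    forall i j, 'E_P[fun w => ((tnth (W w) i - tnth (W w) j) ^+ 2)%R]%E
                = (Gamma i j)%:E.

Definition comp_max (R : realType) (d m : nat) (x : 'I_m.+1 -> d.-tuple R) :
    'cV[R]_d :=
  \col_k \big[Num.max/tnth (x ord0) k]_(i < m.+1) tnth (x i) k.

(* [G] is the limiting distribution function G_Gamma.  Sample sizes are
   n = m.+1, so that the maximum is over a nonempty set; row m may live on its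
   own probability space.
   The constant: b_n ^ 2 ~ 2 log n, so given that component i exceeds b_n, the
   increment b_n (X_j - X_i) has asymptotic variance
     lim b_n ^ 2 (1 - S_ij ^ 2) = 4 lim log n (1 - S_ij).
   For Gamma to be the variogram of the limit model (Huesler and Reiss:
   log n (1 - rho_n) -> lambda ^ 2 with Gamma = 4 lambda ^ 2), the limit of
   log n (1 - S_ij) has to be Gamma_ij / 4. *)
Definition husler_reiss (R : realType) (d : nat) (Gamma : 'M[R]_d)
    (G : 'cV[R]_d -> R) : Prop :=
  is_variogram Gamma /\
  exists (dO : nat -> measure_display) (Om : forall m, measurableType (dO m))
         (P : forall m, probability (Om m) R)
         (X : forall m, 'I_m.+1 -> {RV (P m) >-> d.-tuple R})
         (S : nat -> 'M[R]_d) (b : nat -> R),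
    [/\ forall m, mutually_independent (X m) /\
          forall i, gaussian 0 (S m) (X m i),
        (forall m k, S m k k = 1) /\
          (forall i j, i != j -> (fun m => S m i j) @ \oo --> (1 : R)),
        forall i j,
          (fun m => ln m.+1%:R * (1 - S m i j)) @ \oo --> Gamma i j / 4%:R,
        forall n, (0 < n)%N -> b n = n%:R * normal_pdf 0 1 (b n)
      & forall x : 'cV[R]_d,
          (fun m => fine (P m [set w |
             le_vec (b m.+1 *:
                     (comp_max (fun i => X m i w) - b m.+1 *: ones R d)) x]))
          @ \oo --> G x ].

Definition gen_pareto (R : realType) (d : nat) (G : 'cV[R]_d -> R)
    (dO : measure_display) (Om : measurableType dO) (P : probability Om R)
    (Z : {RV P >-> d.-tuple R}) : Prop :=
  forall z : 'cV[R]_d,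
    P [set w | le_vec (col_of_tuple (Z w)) z] =
    ((ln (G (map_mx (fun t => Num.min t 0) z)) - ln (G z)) / ln (G 0))%:E.

(* [Zs] has the conditional law of [Z] given Z^T 1 >= 0. *)
Definition cond_nonneg_sum (R : realType) (d : nat)
    (dO : measure_display) (Om : measurableType dO) (P : probability Om R)
    (Z : {RV P >-> d.-tuple R})
    (dO' : measure_display) (Om' : measurableType dO') (P' : probability Om' R)
    (Zs : {RV P' >-> d.-tuple R}) : Prop :=
  let E := [set w | 0 <= \sum_k tnth (Z w) k] in
  forall B : set (d.-tuple R), measurable B ->
    distribution P' Zs B = (fine (P (Z @^-1` B `&` E)) / fine (P E))%:E.

Definition profile (R : realType) (d : nat)
    (dO : measure_display) (Om : measurableType dO) (P : probability Om R)
    (Z : {RV P >-> d.-tuple R})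
    (dU : measure_display) (OmU : measurableType dU) (PU : probability OmU R)
    (U : {RV PU >-> d.-tuple R}) : Prop :=
  exists (dS : measure_display) (OmS : measurableType dS)
         (PS : probability OmS R) (Zs : {RV PS >-> d.-tuple R}),
    cond_nonneg_sum Z Zs /\
    forall B : set (d.-tuple R), measurable B ->
      distribution PU U B =
      PS [set w | let z := col_of_tuple (Zs w) in
                  B (tuple_of_col (z - vmean z *: ones R d))].

Definition centering (R : realType) (d : nat) : 'M[R]_d :=
  1%:M - d%:R^-1 *: (ones R d *m (ones R d)^T).

Definition profile_cov (R : realType) (d : nat) (Gamma : 'M[R]_d) : 'M[R]_d :=
  - 2^-1 *: (centering R d *m Gamma *m centering R d).

Definition profile_mean (R : realType) (d : nat) (S : 'M[R]_d) : 'cV[R]_d :=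
  - 2^-1 *: (mdiag S - vmean (mdiag S) *: ones R d).

(* Main.v *)
Require Import Defs.
From HB Require Import structures.
From mathcomp Require Import all_boot all_order all_algebra.
From mathcomp Require Import all_classical all_reals all_analysis.
From mathcomp Require Import measurable_realfun.
From mathcomp Require Import ring lra.

(* Write A_m for a factor of the m-th covariance matrix, rotated so that the sum
   of the coordinates of a row depends on the first standard normal variable
   only; rotations preserve the standard Gaussian law.  Put that mean coordinate
   equal to b + s / b.  The expected number of exceedances in row m is then an
   integral over s and the remaining variables t, and along a subsequence its
   integrand converges to K exp(-s) 1{s + mu + B t is not <= x} with
   B B^T = Sigma: the Gaussian part is already centered and the drift produced
   by the conditioning is mu.  Dominated convergence gives
     - ln G(x) = K int exp(-s) P(s + mu + B Y is not <= x) ds.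
   Hence Z follows the normalised restriction to {not <= 0} of the image of
   K exp(-s) ds x N(0, I) under (s, t) |-> s + mu + B t.  As mu and the columns
   of B sum to zero, the event Z^T 1 >= 0 is s >= 0, and centering leaves
   mu + B Y. *)

Set Implicit Arguments.
Unset Strict Implicit.
Unset Printing Implicit Defensive.

Import Order.TTheory GRing.Theory Num.Theory.
Import numFieldNormedType.Exports.

Local Open Scope classical_set_scope.
Local Open Scope ring_scope.

(** Everything is carried by factors instead: a Gaussian vector is an affine image of independent
    standard normals, and two factors of one covariance differ by a rotation. The mean is the
    coordinate singled out because the profile conditions on the sign of the sum. If the mean is tau
    t_0, component k has regression coefficient u_k = A_k0 / tau on it, and when the mean is b + s /
    b the rescaled height b (X_k - b) equals b^2 (u_k - 1) + u_k s plus a residual independent of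
    the mean. The limit of b^2 (u_k - 1) is mu_k: this is the origin of the drift. The constant is K
    = exp(- w / 2), where w is the limit of b^2 (tau^-2 - 1), namely the mean of all entries of
    Gamma / 2; it cancels on conditioning. The Gram matrices of the residual factors converge, but a
    factor is determined by its Gram matrix only up to rotation, whence the subsequence. It is
    chosen once for all x, and nothing is lost since G(x) is the limit along the full sequence. *)

(* [lebesgue_measure] lives on an alias of [R] with its own measurability
   display; [leb] and [stdnormal] are transported to [R] itself, so that they
   can be combined with [d.-tuple R]. *)
Definition leb (R : realType) : set R -> \bar R := lebesgue_measure.

(** * Lebesgue measure and affine substitutions *)

Section leb_measure.
Variable R : realType.

Let leb0 : @leb R set0 = 0%E. Proof. exact: measure0. Qed.

Let leb_ge0 A : (0 <= @leb R A)%E. Proof. exact: measure_ge0. Qed.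

Let leb_sigma_additive : semi_sigma_additive (@leb R).
Proof. exact: (@measure_semi_sigma_additive _ _ _ (@lebesgue_measure R)). Qed.

HB.instance Definition _ := isMeasure.Build _ _ _ (@leb R)
  leb0 leb_ge0 leb_sigma_additive.

Let leb_sigma_finite : sigma_finite [set: R] (@leb R).
Proof. exact: (sigma_finiteT (@lebesgue_measure R)). Qed.

HB.instance Definition _ := Measure_isSigmaFinite.Build _ _ _ (@leb R)
  leb_sigma_finite.

Lemma leb_itv (i : interval R) : leb [set` i] =
  (if i.1 < i.2 then (i.2 : \bar R) - i.1 else 0)%E.
Proof. exact: lebesgue_measure_itv. Qed.

Lemma leb_unique (mu : {measure set R -> \bar R}) :
  (forall X, ocitv X -> leb X = mu X) ->
  forall A, measurable A -> leb A = mu A.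
Proof.
move=> h A mA.
have mid : measurable_fun [set: R] (idfun : R -> measurableTypeR R).
  by move=> _ Y mY; rewrite setTI.
pose m : {measure set (measurableTypeR R) -> \bar R} := pushforward mu (idfun : R -> measurableTypeR R).
have := @lebesgue_measure_unique R (m mid) h A; apply; exact: mA.
Qed.

Lemma integral_leb (f : R -> \bar R) :
  measurable_fun [set: R] f -> (forall x, 0 <= f x)%E ->
  (\int[@leb R]_x f x = \int[lebesgue_measure]_x f x)%E.
Proof.
move=> mf f0.
have mid : measurable_fun [set: measurableTypeR R] (idfun : measurableTypeR R -> R).
  by move=> _ Y mY; rewrite setTI.
transitivity (\int[pushforward (@lebesgue_measure R) (idfun : measurableTypeR R -> R)]_x f x)%E.
  by apply: eq_measure_integral => A mA _.
by rewrite ge0_integral_pushforward.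
Qed.

End leb_measure.

Section lebesgue_affine.
Variable R : realType.
Notation leb := (@leb R).

Lemma measurable_affine (a c : R) :
  measurable_fun [set: R] (fun x : R => a * x + c).
Proof. by apply: measurable_funD => //; exact: measurable_funM. Qed.

(** Both sides are measures in [A], so half-open intervals suffice. A negative [a] swaps the closed
    and the open end of the preimage, which is why the two signs are computed separately. *)
Lemma leb_affine (a c : R) (A : set R) : a != 0 -> measurable A ->
  (`|a|%:E * leb ((fun x => (a * x + c)%R) @^-1` A) = leb A)%E.
Proof.
move=> a0 mA.
have ma := @measurable_affine a c.
pose m : {measure set R -> \bar R} :=
  mscale (NngNum (normr_ge0 a)) (pushforward leb (fun x : R => a * x + c)).
rewrite -[LHS]/(m ma A).
apply/esym; apply: (@leb_unique R (m ma)) mA => X [[u v]] /= uv <-.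
change (leb `]u, v]%classic =
  (`|a|%:E * leb ((fun x => (a * x + c)%R) @^-1` `]u, v]%classic))%E).
have [a_lt0|a_gt0|/eqP] := ltgtP a 0; last by rewrite (negbTE a0).
  have -> : (fun x => a * x + c) @^-1` `]u, v] =
     `[(v - c) / a, ((u - c) / a)[%classic.
    apply/seteqP; split => x /=; rewrite !in_itv/= => /andP[h1 h2].
      by rewrite ler_ndivrMr// ltr_ndivlMr// mulrC lerBrDr ltrBlDr h1 h2.
    by move: h1 h2; rewrite ler_ndivrMr// ltr_ndivlMr// mulrC lerBrDr ltrBlDr => -> ->.
  rewrite !leb_itv/= !lte_fin ltr_ndivlMr// divfK// ltrD2r.
  case: ifP => [uv'|]; last by rewrite mule0.
  rewrite -!EFinB -EFinM ltr0_norm//; congr EFin; field; exact: a0.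
have -> : (fun x => a * x + c) @^-1` `]u, v] =
     `]((u - c) / a), ((v - c) / a)]%classic.
  apply/seteqP; split => x /=; rewrite !in_itv/= => /andP[h1 h2].
    by rewrite ler_pdivlMr// ltr_pdivrMr// mulrC lerBrDr ltrBlDr h1 h2.
  by move: h1 h2; rewrite ler_pdivlMr// ltr_pdivrMr// mulrC lerBrDr ltrBlDr => -> ->.
rewrite !leb_itv/= !lte_fin ltr_pdivrMr// divfK// ltrD2r.
case: ifP => [uv'|]; last by rewrite mule0.
rewrite -!EFinB -EFinM gtr0_norm//; congr EFin; field; exact: a0.
Qed.

Lemma ge0_integral_affine (a c : R) (f : R -> \bar R) : a != 0 ->
  measurable_fun [set: R] f -> (forall x, 0 <= f x)%E ->
  (\int[leb]_x f x = `|a|%:E * \int[leb]_x f (a * x + c)%R)%E.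
Proof.
move=> a0 mf f0.
have ma := @measurable_affine a c.
pose m : {measure set R -> \bar R} := pushforward leb (fun x : R => a * x + c).
transitivity (\int[mscale (NngNum (normr_ge0 a)) (m ma)]_x f x)%E.
  apply: eq_measure_integral => A mA _.
  exact/esym/(leb_affine c a0 mA).
rewrite ge0_integral_mscale//; congr (_ * _)%E.
by rewrite ge0_integral_pushforward.
Qed.

End lebesgue_affine.

(* The reflection (x, y) |-> (a x + b y, b x - a y) of the plane is a
   composition of two one-dimensional affine substitutions. *)
Lemma ge0_integral_reflection (R : realType) (a b : R)
    (h : R * R -> \bar R) : a ^+ 2 + b ^+ 2 = 1 ->
  measurable_fun [set: R * R] h -> (forall z, 0 <= h z)%E ->
  (\int[@leb R]_x \int[@leb R]_y h (a * x + b * y, b * x - a * y)%R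
   = \int[@leb R]_x \int[@leb R]_y h (x, y))%E.
Proof.
move=> ab1 mh h0.
have mc1 (f g : R -> R) : measurable_fun [set: R] f -> measurable_fun [set: R] g ->
  measurable_fun [set: R] (fun x => h (f x, g x)).
  by move=> mf mg; apply: measurableT_comp => //; exact: measurable_fun_pair.
have mr : measurable_fun [set: R * R]
    (fun z : R * R => h (a * z.1 + b * z.2, b * z.1 - a * z.2)%R).
  apply: measurableT_comp => //; apply: measurable_fun_pair.
    by apply: measurable_funD; exact: measurable_funM.
  by apply: measurable_funB; exact: measurable_funM.
(* For a = 0 the map is an exchange of the variables combined with the factor b = 1 or -1; otherwise
   one may divide by [a]. *)
have [a0|a0] := eqVneq a 0.
  rewrite a0 in ab1 *.
  have b0 : b != 0 by apply/eqP => b0; move: ab1; rewrite b0; lra.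
  have nb : `|b| = 1.
    by apply/eqP; rewrite -sqrp_eq1// real_normK ?num_real//; apply/eqP; lra.
  under eq_integral do under eq_integral do rewrite !mul0r add0r subr0.
  have step x : (\int[@leb R]_y h (b * y, b * x)%R = \int[@leb R]_y h (y, b * x)%R)%E.
    rewrite [RHS](@ge0_integral_affine _ b 0 (fun y => h (y, b * x)))//; last first.
      exact: mc1.
    by rewrite nb mul1e; under [RHS]eq_integral do rewrite addr0.
  under eq_integral do rewrite step.
  transitivity (\int[@leb R]_x \int[@leb R]_y h (y, x))%E; last first.
    exact: (esym (fubini_tonelli (m1 := @leb R) (m2 := @leb R) h mh h0)).
  rewrite [RHS](@ge0_integral_affine _ b 0 (fun x => \int[@leb R]_y h (y, x))%E)//.
  - by rewrite nb mul1e; under [RHS]eq_integral do rewrite addr0.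
  - exact: (measurable_fun_fubini_tonelli_G (m1 := @leb R) h mh h0).
  - by move=> x; exact: integral_ge0.
(* Half-way integrand: its first variable is already the new coordinate u = a x + b y, its second is
   still y. Since a^2 + b^2 = 1, the other new coordinate b x - a y equals (b u - y) / a. *)
pose k z := h (z.1, (b * z.1 - z.2) / a)%R.
have mk : measurable_fun [set: R * R] k.
  apply: measurableT_comp => //; apply: measurable_fun_pair => //.
  apply: measurable_funM => //; apply: measurable_funB => //.
  exact: measurable_funM.
transitivity (`|a|^-1%:E * \int[@leb R]_x \int[@leb R]_y k (x, y))%E.
  rewrite (fubini_tonelli (m1 := @leb R) (m2 := @leb R) k mk (fun z => h0 _)).
  have := fubini_tonelli (m1 := @leb R) (m2 := @leb R) _ mr (fun z => h0 _).
  rewrite /= => ->.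
  rewrite -ge0_integralZl//; first last.
  - by move=> y _; apply: integral_ge0 => x _; exact: h0.
  - exact: (measurable_fun_fubini_tonelli_G (m1 := @leb R) k mk (fun z => h0 _)).
  apply: eq_integral => y _.
  have mky : measurable_fun [set: R] (fun x => k (x, y)).
    by apply: measurableT_comp mk _; exact: measurable_fun_pair.
  rewrite [in RHS](ge0_integral_affine (b * y) a0 mky (fun x => h0 _)).
  rewrite muleA -EFinM mulVf ?normr_eq0// mul1e.
  apply: eq_integral => x _; rewrite /k /=; congr (h (_, _)).
  have -> : b * x - a * y = b * x - ((a ^+ 2 + b ^+ 2) * y - b ^+ 2 * y) / a.
    by field.
  rewrite ab1; by field.
rewrite -ge0_integralZl//; first last.
- by move=> y _; apply: integral_ge0 => x _; exact: h0.
- exact: (measurable_fun_fubini_tonelli_F (m2 := @leb R) k mk (fun z => h0 _)).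
apply: eq_integral => x _.
have mhx : measurable_fun [set: R] (fun y => h (x, y)) by exact: mc1.
have a0' : - a^-1 != 0 by rewrite oppr_eq0 invr_eq0.
rewrite [RHS](ge0_integral_affine (b * x / a) a0' mhx (fun y => h0 _)).
rewrite normrN normfV; congr (_ * _)%E; apply: eq_integral => y _.
rewrite /k /=; congr (h (_, _)); field; exact: a0.
Qed.

(** * Standard normal measure *)

Section density.
Local Open Scope ereal_scope.
Context d (T : measurableType d) (R : realType).
Variables (mu nu : {measure set T -> \bar R}) (p : T -> R).
Hypotheses (mp : measurable_fun [set: T] p) (p0 : forall x, (0 <= p x)%R).
Hypothesis nup : forall A, measurable A -> nu A = \int[mu]_(x in A) (p x)%:E.

Import HBNNSimple.

Let integral_density_nnsfun (h : {nnsfun T >-> R}) :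
  \int[mu]_x ((h x)%:E * (p x)%:E) = \int[nu]_x (h x)%:E.
Proof.
transitivity (\int[nu]_x
   (\sum_(y \in range h) (y * \1_(h @^-1` [set y]) x)%:E)); last first.
  by apply: eq_integral => t tE; rewrite /= fimfunE -fsumEFin.
have indich r : measurable_fun [set: T] (fun x => (r * \1_(h @^-1` [set r]) x)%:E).
  by apply: (measurable_comp measurableT) => //; exact: measurable_funM.
rewrite ge0_integral_fsum//; last by move=> m y Ey; exact: nnfun_muleindic_ge0.
transitivity (\int[mu]_x (\sum_(y \in range h)
    (y * \1_(h @^-1` [set y]) x)%:E * (p x)%:E)).
  apply: eq_integral => x _.
  rewrite -ge0_mule_fsuml => [|y]; last exact: nnfun_muleindic_ge0.
  by rewrite fsumEFin // -(fimfunE _ x).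
rewrite ge0_integral_fsum//; last 2 first.
  - move=> r; apply: emeasurable_funM => //; exact/measurable_EFinP.
  - by move=> r x _; rewrite mule_ge0 ?lee_fin//; exact: nnfun_muleindic_ge0.
apply: eq_fsbigr => r; rewrite inE => -[t _ htr].
have r0 : (0 <= r)%R by rewrite -htr.
have mhr : measurable (h @^-1` [set r]) by exact: measurable_sfunP.
transitivity (r%:E * \int[mu]_(x in h @^-1` [set r]) (p x)%:E).
  rewrite [in RHS]integral_mkcond -ge0_integralZl//.
  - apply: eq_integral => x _; rewrite EFinM -muleA; congr (_ * _).
    rewrite patchE indicE; case: ifPn => _; by rewrite ?mul1e ?mul0e.
  - by apply/measurable_restrict => //; apply: measurable_funTS; exact/measurable_EFinP.
  - by move=> x _; rewrite patchE; case: ifPn; rewrite ?lee_fin.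
rewrite -nup//.
under [RHS]eq_integral do rewrite EFinM.
rewrite ge0_integralZl//.
- by rewrite integral_indic// setIT.
- exact/measurable_EFinP.
Qed.

Lemma ge0_integral_density (f : T -> \bar R) :
  measurable_fun [set: T] f -> (forall x, 0 <= f x) ->
  \int[nu]_x f x = \int[mu]_x (f x * (p x)%:E).
Proof.
move=> mf f0; pose h := nnsfun_approx measurableT mf.
have -> : \int[nu]_x f x = lim (\int[nu]_x (EFin \o h n) x @[n --> \oo]).
  have fE x : f x = lim ((EFin \o h n) x @[n --> \oo]).
    by apply/esym/cvg_lim => //; exact: cvg_nnsfun_approx.
  under eq_integral do rewrite fE.
  apply: monotone_convergence => //.
  - by move=> n; exact/measurable_EFinP/measurable_funP.
  - by move=> n x Ex //=; rewrite lee_fin.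
  - by move=> x Ex a b ab; rewrite lee_fin; exact/lefP/nd_nnsfun_approx.
have -> : \int[mu]_x (f x * (p x)%:E) =
    lim (\int[mu]_x ((h n x)%:E * (p x)%:E) @[n --> \oo]).
  have fE x : f x * (p x)%:E = lim (((h n x)%:E * (p x)%:E) @[n --> \oo]).
    apply/esym/cvg_lim => //; apply: cvgeZr => //.
    exact: cvg_nnsfun_approx.
  under eq_integral do rewrite fE.
  apply: monotone_convergence => //.
  - move=> n; apply: emeasurable_funM => //; exact/measurable_EFinP.
  - by move=> n x Ex /=; rewrite mule_ge0 ?lee_fin.
  - by move=> x Ex a b ab/=; rewrite lee_wpmul2r ?lee_fin//; exact/lefP/nd_nnsfun_approx.
by under [in RHS]eq_fun do rewrite integral_density_nnsfun.
Qed.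

End density.

Definition stdnormal (R : realType) : set R -> \bar R := normal_prob 0 1.

Section stdnormal.
Variable R : realType.
Local Notation phi := (normal_pdf (0 : R) 1).

Let stdnormal0 : @stdnormal R set0 = 0%E. Proof. exact: measure0. Qed.

Let stdnormal_ge0 A : (0 <= @stdnormal R A)%E. Proof. exact: measure_ge0. Qed.

Let stdnormal_sigma_additive : semi_sigma_additive (@stdnormal R).
Proof. exact: (@measure_semi_sigma_additive _ _ _ (@normal_prob R 0 1)). Qed.

HB.instance Definition _ := isMeasure.Build _ _ _ (@stdnormal R)
  stdnormal0 stdnormal_ge0 stdnormal_sigma_additive.

Let stdnormal_setT : @stdnormal R setT = 1%E.
Proof. exact: (@probability_setT _ _ _ (@normal_prob R 0 1)). Qed.

HB.instance Definition _ :=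
  @Measure_isProbability.Build _ _ R (@stdnormal R) stdnormal_setT.

Lemma ge0_integral_stdnormal (f : R -> \bar R) :
  measurable_fun [set: R] f -> (forall x, 0 <= f x)%E ->
  (\int[@stdnormal R]_x f x = \int[@leb R]_x (f x * (phi x)%:E))%E.
Proof.
move=> mf f0.
have mphi : measurable_fun [set: R] phi by exact: measurable_normal_pdf.
apply: ge0_integral_density => //; first by move=> x; exact: normal_pdf_ge0.
move=> A mA.
have mr : measurable_fun [set: R] ((fun x => (phi x)%:E) \_ A).
  by apply/measurable_restrict => //; apply/measurable_funTS/measurable_EFinP.
rewrite [RHS]integral_mkcond integral_leb//; last first.
  by move=> x; rewrite patchE; case: ifPn; rewrite ?lee_fin ?normal_pdf_ge0.
exact: integral_mkcond.
Qed.

Lemma normal_pdf01E (x : R) :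
  phi x = normal_peak 1 * expR (- x ^+ 2 / 2).
Proof.
rewrite normal_pdfE ?oner_eq0// /normal_fun subr0 expr1n; congr (_ * expR (_ / _)).
Qed.

(** The product density depends on x^2 + y^2 only, which the reflection preserves, so it can be
    absorbed in the integrand of the Lebesgue statement. *)
Lemma ge0_integral_stdnormal_reflection (a b : R) (h : R * R -> \bar R) :
  a ^+ 2 + b ^+ 2 = 1 ->
  measurable_fun [set: R * R] h -> (forall z, 0 <= h z)%E ->
  (\int[@stdnormal R]_x \int[@stdnormal R]_y h (a * x + b * y, b * x - a * y)%R
   = \int[@stdnormal R]_x \int[@stdnormal R]_y h (x, y))%E.
Proof.
move=> ab1 mh h0.
have mphi : measurable_fun [set: R] phi by exact: measurable_normal_pdf.
have toleb (g : R * R -> \bar R) : measurable_fun [set: R * R] g ->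
    (forall z, 0 <= g z)%E ->
    (\int[@stdnormal R]_x \int[@stdnormal R]_y g (x, y) =
     \int[@leb R]_x \int[@leb R]_y (g (x, y) * (phi y * phi x)%:E))%E.
  move=> mg g0.
  rewrite ge0_integral_stdnormal; first last.
  - by move=> x; exact: integral_ge0.
  - exact: (measurable_fun_fubini_tonelli_F (m2 := @stdnormal R) g mg g0).
  apply: eq_integral => x _.
  have mgx : measurable_fun [set: R] (fun y => g (x, y)).
    by apply: measurableT_comp mg _; exact: measurable_fun_pair.
  rewrite ge0_integral_stdnormal//.
  rewrite -ge0_integralZr//.
  - by apply: eq_integral => y _; rewrite EFinM muleA.
  - by apply: emeasurable_funM => //; exact/measurable_EFinP.
  - by move=> y _; rewrite mule_ge0// lee_fin normal_pdf_ge0.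
  - by rewrite lee_fin normal_pdf_ge0.
rewrite (toleb h)//.
have mr : measurable_fun [set: R * R]
    (fun z : R * R => h (a * z.1 + b * z.2, b * z.1 - a * z.2)%R).
  apply: measurableT_comp => //; apply: measurable_fun_pair.
    by apply: measurable_funD; exact: measurable_funM.
  by apply: measurable_funB; exact: measurable_funM.
rewrite (toleb _ mr (fun z => h0 _)) /=.
pose k (z : R * R) := (h z * (phi z.2 * phi z.1)%:E)%E.
have mk : measurable_fun [set: R * R] k.
  apply: emeasurable_funM => //; apply/measurable_EFinP.
  by apply: measurable_funM; exact: measurableT_comp.
have k0 z : (0 <= k z)%E.
  by rewrite mule_ge0// lee_fin mulr_ge0 ?normal_pdf_ge0.
rewrite -(ge0_integral_reflection ab1 mk k0).
apply: eq_integral => x _; apply: eq_integral => y _.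
rewrite /k /=; congr (_ * _%:E)%E.
rewrite !normal_pdf01E mulrACA [RHS]mulrACA -!expRD; congr (_ * expR _).
have -> : - y ^+ 2 / 2 + - x ^+ 2 / 2 = - ((a ^+ 2 + b ^+ 2) * (x ^+ 2 + y ^+ 2)) / 2.
  by rewrite ab1; field.
by field.
Qed.

End stdnormal.

(** * Standard Gaussian measure on tuples *)

Section cons_tuple.
Variables (R : realType) (d : nat).

Definition cons_pair (p : R * d.-tuple R) : d.+1.-tuple R :=
  [tuple of p.1 :: p.2].

Lemma measurable_cons_pair : measurable_fun [set: R * d.-tuple R] cons_pair.
Proof. exact: (@measurable_cons _ _ _ _ fst _ snd). Qed.

HB.instance Definition _ :=
  isMeasurableFun.Build _ _ _ _ cons_pair measurable_cons_pair.

Lemma measurable_consl (x : R) : measurable_fun [set: d.-tuple R] (cons_pair \o pair x).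
Proof. by apply: measurableT_comp => //; exact: measurable_fun_pair. Qed.

End cons_tuple.

(** The law N(0, I), built by adjoining one normal coordinate at a time, so that the Tonelli theorem
    detaches the first coordinate. *)
Fixpoint gam (R : realType) (d : nat) : probability (d.-tuple R) R :=
  match d return probability (d.-tuple R) R with
  | 0 => dirac ([tuple] : 0.-tuple R)
  | d'.+1 => distribution (@stdnormal R \x gam R d')%E (@cons_pair R d')
  end.

Section gam.
Variable R : realType.

Lemma ge0_integral_gamS d (f : d.+1.-tuple R -> \bar R) :
  measurable_fun setT f -> (forall t, 0 <= f t)%E ->
  (\int[gam R d.+1]_t f t =
   \int[@stdnormal R]_x \int[gam R d]_t f (cons_pair (x, t)))%E.
Proof.
move=> mf f0; rewrite [LHS](ge0_integral_distribution _ mf f0).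
have mc : measurable_fun [set: R * d.-tuple R] (f \o @cons_pair R d).
  by apply: measurableT_comp => //; exact: measurable_cons_pair.
by rewrite (fubini_tonelli1 _ mc)// => z /=; exact: f0.
Qed.

Lemma gam_rect d (A : 'I_d -> set R) : (forall i, measurable (A i)) ->
  (gam R d [set t | forall i, A i (tnth t i)] = \prod_(i < d) stdnormal (A i))%E.
Proof.
elim: d A => [|d IH] A mA.
  rewrite big_ord0 /= diracE mem_set//; by case.
rewrite big_ord_recl -IH// -product_measure1E//.
- rewrite /gam -/gam /distribution /pushforward /=; congr (product_measure1 _ _ _).
  apply/seteqP; split => -[x t] /=.
    move=> h; split; first exact: (h ord0).
    by move=> i; have := h (lift ord0 i); rewrite tnthS.
  move=> [h0 h] i; case: (unliftP ord0 i) => [j ->|-> //].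
  by rewrite tnthS.
- rewrite -[X in measurable X](_ : \bigcap_(i in [set: 'I_d])
     ((fun t : d.-tuple R => tnth t i) @^-1` (A (lift ord0 i))) = _); last first.
    by apply/seteqP; split => t /= h i; [exact: h|move=> _; exact: h].
  apply: fin_bigcap_measurable => // i _.
  by rewrite -[X in measurable X]setTI; exact: measurable_tnth.
Qed.

End gam.

(** * Lower orthants determine finite measures *)

Section orthant.
Variables (R : realType) (d : nat).

Definition orthant (z : 'cV[R]_d) : set (d.-tuple R) :=
  [set t | le_vec (col_of_tuple t) z].

Lemma orthantE z : orthant z =
  \bigcap_(i in [set: 'I_d]) ((fun t => tnth t i) @^-1` [set` `]-oo, z i 0]]).
Proof.
apply/seteqP; split => t /= h i; last first.
  by have := h i I; rewrite /= in_itv/= mxE.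
by move=> _; rewrite /= in_itv/=; have := h i; rewrite mxE.
Qed.

Lemma measurable_orthant z : measurable (orthant z).
Proof.
rewrite orthantE; apply: fin_bigcap_measurable => // i _.
by rewrite -[X in measurable X]setTI; apply: measurable_tnth.
Qed.

Lemma orthant_cover :
  \bigcup_n orthant (const_mx n%:R) = [set: d.-tuple R].
Proof.
apply/seteqP; split => // t _.
pose M := \sum_i `|tnth t i|.
have [n Mn] : exists n : nat, M <= n%:R.
  exists (Num.truncn M).+1; apply/ltW/truncnS_gt.
exists n => // i; rewrite !mxE.
apply: le_trans (ler_norm _) _; apply: le_trans Mn.
by rewrite /M (bigD1 i)//= lerDl sumr_ge0.
Qed.

Let G := [set orthant z | z in [set: 'cV[R]_d]].

Let G_setI : setI_closed G.
Proof.
move=> _ _ [z _ <-] [w _ <-]; exists (\col_i Num.min (z i 0) (w i 0)) => //.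
apply/seteqP; split => t /=.
  by move=> h; split => i; have := h i; rewrite !mxE le_min => /andP[].
by move=> [h1 h2] i; rewrite !mxE le_min; have := h1 i; have := h2 i; rewrite !mxE => -> ->.
Qed.

Let G_measurable : measurable = <<s G >>.
Proof.
apply/seteqP; split; last first.
  apply: smallest_sub; first exact: sigma_algebra_measurable.
  by move=> _ [z _ <-]; exact: measurable_orthant.
pose T' := g_sigma_algebraType G.
have mid : measurable_fun [set: T'] (idfun : T' -> d.-tuple R).
  apply/measurable_fun_tnthP => i.
  apply: (measurability _ (RGenOInfty.measurableE R)) => //.
  move=> _ [_ [a ->] <-]; rewrite setTI.
  (* A half-space bounding one coordinate is an increasing union of orthants: the other coordinates
     are bounded by n, and n grows. *)
  have -> : ((fun t : d.-tuple R => tnth t i) \o (idfun : T' -> d.-tuple R)) @^-1` `]a, +oo[%classic =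
    ~` \bigcup_(n : nat) (orthant (\col_j if j == i then a else n%:R) : set T').
    apply/seteqP; split => t /=.
      rewrite in_itv/= andbT => ai [n _ /(_ i)].
      by rewrite !mxE eqxx leNgt ai.
    rewrite in_itv/= andbT ltNge => h; apply/negP => ta; apply: h.
    have [n _ hn] : (\bigcup_n orthant (const_mx n%:R)) t by rewrite orthant_cover.
    exists n => // j; rewrite !mxE; case: eqVneq => [->//|_].
    by have := hn j; rewrite !mxE.
  apply: measurableC; apply: bigcupT_measurable => n.
  by apply: sub_sigma_algebra; exists (\col_j if j == i then a else n%:R).
move=> A mA; have := mid measurableT A mA; rewrite setTI; exact.
Qed.

(** Orthants are stable under intersection (componentwise minimum) and generate the sigma-algebra.
    This is what lets a distribution function, the only datum in [gen_pareto], determine a law. *)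
Lemma orthant_unique (m1 m2 : {measure set (d.-tuple R) -> \bar R}) :
  (forall z, m1 (orthant z) = m2 (orthant z)) -> (m1 setT < +oo)%E ->
  forall A, measurable A -> m1 A = m2 A.
Proof.
move=> h m1oo A mA.
apply: (measure_unique G (fun n => orthant (const_mx n%:R))) => //.
- by move=> n; exists (const_mx n%:R).
- exact: orthant_cover.
- by move=> _ [z _ <-]; exact: h.
- move=> n; apply: le_lt_trans m1oo; apply: le_measure; rewrite ?inE//.
  exact: measurable_orthant.
Qed.

End orthant.

Section affmap.
Variable R : realType.

Lemma col_of_tupleK d : cancel (@col_of_tuple R d) (@tuple_of_col R d).
Proof. by move=> t; apply: eq_from_tnth => i; rewrite tnth_mktuple mxE. Qed.

Lemma tuple_of_colK d : cancel (@tuple_of_col R d) (@col_of_tuple R d).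
Proof. by move=> v; apply/colP => i; rewrite mxE tnth_mktuple. Qed.

Lemma col_of_tuple_cons d (x : R) (t : d.-tuple R) :
  col_of_tuple (cons_pair (x, t)) = col_mx x%:M (col_of_tuple t).
Proof.
apply/colP => i; rewrite !mxE; case: splitP => j ij.
  rewrite ord1 in ij *; rewrite mxE eqxx mulr1n.
  by rewrite (_ : i = ord0)//; exact/val_inj.
by rewrite mxE (_ : i = lift ord0 j) ?tnthS//; exact/val_inj.
Qed.

Lemma tuple_of_col_cons d (x : R) (v : 'cV[R]_d) :
  tuple_of_col (col_mx x%:M v : 'cV[R]_d.+1) = cons_pair (x, tuple_of_col v).
Proof.
by apply: (can_inj (@col_of_tupleK _)); rewrite tuple_of_colK col_of_tuple_cons tuple_of_colK.
Qed.

Definition affmap d p (v : 'cV[R]_p) (M : 'M[R]_(p, d)) (t : d.-tuple R)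
  : p.-tuple R := tuple_of_col (v + M *m col_of_tuple t).

Lemma tnth_affmap d p v (M : 'M[R]_(p, d)) t i :
  tnth (affmap v M t) i = v i 0 + \sum_j M i j * tnth t j.
Proof. by rewrite tnth_mktuple !mxE; congr (_ + _); apply: eq_bigr => j _; rewrite mxE. Qed.

Lemma measurable_affmap d p v (M : 'M[R]_(p, d)) :
  measurable_fun setT (affmap v M).
Proof.
apply/measurable_fun_tnthP => i.
rewrite (_ : _ \o _ = fun t => v i 0 + \sum_j M i j * tnth t j); last first.
  by apply/funext => t /=; rewrite tnth_affmap.
apply: measurable_funD => //; apply: measurable_sum => j.
by apply: measurable_funM => //; exact: measurable_tnth.
Qed.

Lemma affmap0M d p q (M : 'M[R]_(q, p)) (N : 'M[R]_(p, d)) t :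
  affmap 0 (M *m N) t = affmap 0 M (affmap 0 N t).
Proof. by rewrite /affmap !add0r tuple_of_colK mulmxA. Qed.

Lemma affmap01 d (t : d.-tuple R) : affmap 0 1%:M t = t.
Proof. by rewrite /affmap add0r mul1mx col_of_tupleK. Qed.

End affmap.

(** * Orthogonal invariance *)

Section orthogonal_invariance.
Variable R : realType.

(** Invariance of [gam] is bundled with orthogonality: it is checked on planar reflections and a
    sign change, and passes to products, transposes and block extensions, which suffices to build
    Householder reflections. *)
Definition gauss_orthogonal d (M : 'M[R]_d) := M *m M^T = 1%:M /\
  forall f : d.-tuple R -> \bar R, measurable_fun setT f -> (forall t, 0 <= f t)%E ->
    (\int[gam R d]_t f (affmap 0 M t) = \int[gam R d]_t f t)%E.

Lemma measurable_comp_affmap d p v (M : 'M[R]_(p, d)) (f : p.-tuple R -> \bar R) :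
  measurable_fun setT f -> measurable_fun setT (f \o affmap v M).
Proof. by move=> mf; apply: (measurableT_comp mf); exact: measurable_affmap. Qed.

Lemma measurable_fun_consl d (f : d.+1.-tuple R -> \bar R) x :
  measurable_fun setT f -> measurable_fun setT (fun t => f (cons_pair (x, t))).
Proof. by move=> mf; exact: (measurableT_comp mf (measurable_consl x)). Qed.

Lemma measurable_fun_cons_pair d dT (T : measurableType dT) (f : T -> R)
    (g : T -> d.-tuple R) :
  measurable_fun setT f -> measurable_fun setT g ->
  measurable_fun setT (fun x => cons_pair (f x, g x)).
Proof.
move=> mf mg; apply: (measurableT_comp (@measurable_cons_pair R d)).
exact: measurable_fun_pair.
Qed.

Lemma ge0_integral_stdnormalN (f : R -> \bar R) :
  measurable_fun [set: R] f -> (forall x, 0 <= f x)%E ->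
  (\int[@stdnormal R]_x f (- x)%R = \int[@stdnormal R]_x f x)%E.
Proof.
move=> mf f0.
have mphi : measurable_fun [set: R] (normal_pdf 0 1 : R -> R) by exact: measurable_normal_pdf.
have mfN : measurable_fun [set: R] (fun x : R => f (- x)) by exact: measurableT_comp.
rewrite !ge0_integral_stdnormal// [RHS](@ge0_integral_affine _ (-1) 0)//.
- rewrite normrN1 mul1e; apply: eq_integral => x _.
  by rewrite mulN1r addr0 !normal_pdf01E sqrrN.
- by apply: emeasurable_funM => //; exact/measurable_EFinP.
- by move=> x; rewrite mule_ge0// lee_fin normal_pdf_ge0.
Qed.

Lemma gauss_orthogonal1 d : gauss_orthogonal (1%:M : 'M[R]_d).
Proof.
split; first by rewrite trmx1 mulmx1.
by move=> f _ _; apply: eq_integral => t _; rewrite affmap01.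
Qed.

Lemma gauss_orthogonalM d (M N : 'M[R]_d) :
  gauss_orthogonal M -> gauss_orthogonal N -> gauss_orthogonal (M *m N).
Proof.
move=> [M1 Mf] [N1 Nf]; split.
  by rewrite trmx_mul mulmxA -(mulmxA M) N1 mulmx1.
move=> f mf f0; under eq_integral do rewrite affmap0M.
by rewrite (Nf _ (measurable_comp_affmap 0 M mf) (fun t => f0 _)) Mf.
Qed.

Lemma gauss_orthogonal_tr d (M : 'M[R]_d) :
  gauss_orthogonal M -> gauss_orthogonal M^T.
Proof.
move=> [M1 Mf]; split; first by rewrite trmxK (mulmx1C M1).
move=> f mf f0; rewrite -(Mf _ (measurable_comp_affmap 0 M^T mf) (fun t => f0 _)).
by apply: eq_integral => t _ /=; rewrite -affmap0M (mulmx1C M1) affmap01.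
Qed.

Lemma gauss_orthogonal_lift d (M : 'M[R]_d) : gauss_orthogonal M ->
  gauss_orthogonal (block_mx 1%:M 0 0 M : 'M[R]_(1 + d)).
Proof.
move=> [M1 Mf]; split.
  rewrite tr_block_mx mulmx_block !(trmx0, trmx1, mulmx0, mul0mx, mulmx1, addr0, add0r).
  by rewrite M1 -scalar_mx_block.
move=> f mf f0; rewrite (ge0_integral_gamS (measurable_comp_affmap 0 _ mf) (fun t => f0 _)).
  rewrite ge0_integral_gamS//.
apply: eq_integral => x _.
rewrite -(Mf _ (measurable_fun_consl x mf) (fun t => f0 _)).
apply: eq_integral => t _; congr f.
rewrite /affmap !add0r col_of_tuple_cons.
rewrite (mul_block_col (1%:M : 'M[R]_1)) !mul0mx addr0 add0r mul1mx.
exact: tuple_of_col_cons.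
Qed.

(** The reflection of the plane with rows (a, b) and (b, -a), acting on the first two coordinates.
    It is symmetric and, when a^2 + b^2 = 1, an involution, which gives orthogonality at once. *)
Definition reflection2_mx d (a b : R) : 'M[R]_(1 + (1 + d)) :=
  block_mx a%:M (row_mx b%:M 0) (col_mx b%:M 0) (block_mx (- a)%:M 0 0 1%:M).

Lemma mul_reflection2_mx d (a b x y : R) (v : 'cV[R]_d) :
  reflection2_mx d a b *m col_mx x%:M (col_mx y%:M v) =
  col_mx (a * x + b * y)%:M (col_mx (b * x - a * y)%:M v).
Proof.
rewrite /reflection2_mx mul_block_col mul_row_col mul_col_mx mul_block_col.
rewrite !mul0mx !addr0 add0r mul1mx -!scalar_mxM -!raddfD /= add_col_mx.
by rewrite add0r mulNr -raddfD.
Qed.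

Lemma gauss_orthogonal_reflection2 d (a b : R) : a ^+ 2 + b ^+ 2 = 1 ->
  gauss_orthogonal (reflection2_mx d a b).
Proof.
move=> ab1; split.
  apply/matrixP => i j.
  have -> : (reflection2_mx d a b)^T = reflection2_mx d a b.
    by rewrite /reflection2_mx !(tr_block_mx, tr_col_mx, tr_row_mx, tr_scalar_mx, trmx0).
  have h (v : 'cV[R]_(1 + (1 + d))) : reflection2_mx d a b *m (reflection2_mx d a b *m v) = v.
    rewrite -[v]vsubmxK -[dsubmx v]vsubmxK [usubmx v]mx11_scalar [usubmx (dsubmx v)]mx11_scalar.
    rewrite !mul_reflection2_mx; congr (col_mx _%:M (col_mx _%:M _)).
      rewrite -[RHS]mul1r -ab1; ring.
    rewrite -[RHS]mul1r -ab1; ring.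
  have /colP/(_ i) := h (delta_mx j 0); rewrite mulmxA -colE [LHS]mxE => ->.
  by rewrite !mxE andbT.
move=> f mf f0.
(* The first two coordinates are moved innermost, so that for each fixed [t] the planar invariance
   applies. *)
have E g : measurable_fun setT g -> (forall t, 0 <= g t)%E ->
  (\int[gam R d.+2]_t g t = \int[gam R d]_t \int[@stdnormal R]_x \int[@stdnormal R]_y
     g (cons_pair (x, cons_pair (y, t))))%E.
  move=> mg g0; rewrite ge0_integral_gamS//.
  under eq_integral => x _.
    rewrite (ge0_integral_gamS (measurable_fun_consl x mg) (fun t => g0 _)).
    over.
  have m3 x : measurable_fun [set: R * d.-tuple R]
      (fun z => g (cons_pair (x, cons_pair z))).
    by apply: (measurableT_comp mg); exact: measurable_fun_cons_pair.
  under eq_integral => x _.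
    rewrite (fubini_tonelli (m1 := @stdnormal R) (m2 := gam R d) _ (m3 x) (fun z => g0 _)).
    over.
  have m3' : measurable_fun [set: (R * d.-tuple R) * R]
      (fun z => g (cons_pair (z.1.1, cons_pair (z.2, z.1.2)))).
    apply: (measurableT_comp mg); apply: measurable_fun_cons_pair.
      exact: measurableT_comp.
    by apply: measurable_fun_cons_pair => //; exact: measurableT_comp.
  have := measurable_fun_fubini_tonelli_F (m2 := @stdnormal R) _ m3' (fun z => g0 _).
  move=> mF.
  exact: (fubini_tonelli (m1 := @stdnormal R) (m2 := gam R d) _ mF
    (fun z => integral_ge0 _ (fun y _ => g0 _))).
rewrite [RHS]E// (E _ (measurable_comp_affmap 0 _ mf) (fun t => f0 _)).
apply: eq_integral => t _.
pose h (z : R * R) := f (cons_pair (z.1, cons_pair (z.2, t))).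
have mh : measurable_fun [set: R * R] h.
  apply: (measurableT_comp mf); apply: measurable_fun_cons_pair => //.
  exact: measurable_fun_cons_pair.
rewrite -[RHS](ge0_integral_stdnormal_reflection ab1 mh (fun z => f0 _)).
apply: eq_integral => x _; apply: eq_integral => y _.
rewrite /h /=; congr f.
rewrite /affmap add0r !col_of_tuple_cons (mul_reflection2_mx a b x y).
by rewrite -[RHS]col_of_tupleK !col_of_tuple_cons.
Qed.

(** By induction the tail of [v] is brought to its own first axis; one planar reflection then sends
    the remaining pair (x, c) to (r, 0), where r is its norm. When r = 0 that pair already
    vanishes. *)
Lemma gauss_orthogonal_to_axis d (v : 'cV[R]_d.+1) :
  exists2 M, gauss_orthogonal M & exists c : R, M *m v = col_mx c%:M 0 :> 'cV[R]_(1 + d).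
Proof.
elim: d v => [|d IH] v.
  exists 1%:M; first exact: gauss_orthogonal1.
  exists (v 0 0); rewrite mul1mx; apply/colP => i; rewrite ord1 mxE.
  by case: splitP => [j _|[]//]; rewrite ord1 mxE eqxx.
have [M gM [c Mc]] := IH (dsubmx (v : 'cV[R]_(1 + d.+1))).
pose x := (usubmx (v : 'cV[R]_(1 + d.+1))) 0 0.
pose r := Num.sqrt (x ^+ 2 + c ^+ 2).
have xc0 : 0 <= x ^+ 2 + c ^+ 2 by rewrite addr_ge0 ?sqr_ge0.
have r2 : r ^+ 2 = x ^+ 2 + c ^+ 2 by rewrite sqr_sqrtr.
have step1 : (block_mx 1%:M 0 0 M : 'M[R]_(1 + d.+1)) *m v = col_mx x%:M (col_mx c%:M 0).
  rewrite -[v in LHS](@vsubmxK _ 1 d.+1 1 v) (mul_block_col (1%:M : 'M[R]_1)).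
  by rewrite !mul0mx mul1mx addr0 add0r [X in col_mx X _]mx11_scalar Mc.
have [r0|r0] := eqVneq r 0.
  exists (block_mx 1%:M 0 0 M : 'M[R]_(1 + d.+1)); first exact: gauss_orthogonal_lift.
  exists x; rewrite step1; congr col_mx.
  have /eqP : x ^+ 2 + c ^+ 2 = 0 by rewrite -r2 r0 expr0n.
  rewrite paddr_eq0 ?sqr_ge0// => /andP[_]; rewrite sqrf_eq0 => /eqP ->.
  by rewrite raddf0 col_mx0.
exists (reflection2_mx d (x / r) (c / r) *m block_mx 1%:M 0 0 M : 'M[R]_(1 + d.+1)).
  apply: gauss_orthogonalM; last exact: gauss_orthogonal_lift.
  apply: gauss_orthogonal_reflection2.
  by rewrite !expr_div_n -mulrDl -r2 divff// sqrf_eq0.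
exists r; rewrite -mulmxA step1 mul_reflection2_mx; congr (col_mx _%:M _).
  by rewrite mulrAC (mulrAC c) -mulrDl -!expr2 -r2 expr2 mulfK.
rewrite (_ : c / r * x - x / r * c = 0); last by ring.
by rewrite raddf0 col_mx0.
Qed.

(* The witness is the Householder reflection along [v - w]. *)
Lemma gauss_orthogonal_reflection d (v w : 'cV[R]_d) :
  v^T *m v = w^T *m w ->
  exists2 M, gauss_orthogonal M &
    M *m v = w /\ forall u : 'cV[R]_d, (v - w)^T *m u = 0 -> M *m u = u.
Proof.
case: d v w => [|d] v w vw.
  exists 1%:M; first exact: gauss_orthogonal1.
  by split=> [|u _]; apply/matrixP => -[].
have [vw0|vw0] := eqVneq (v - w) 0.
  exists 1%:M; first exact: gauss_orthogonal1.
  by split=> [|u _]; rewrite mul1mx//; apply/eqP; rewrite -subr_eq0 vw0.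
have [M gM [c Mc]] := gauss_orthogonal_to_axis (v - w).
(* [D] changes the sign of the first axis. As [M] carries [v - w] to that axis, the conjugate M^T D
   M reverses [v - w] and fixes its orthogonal complement. *)
pose D : 'M[R]_(1 + d) := block_mx (-1)%:M 0 0 1%:M.
have gD : gauss_orthogonal D.
  split.
    rewrite tr_block_mx mulmx_block !(trmx0, trmx1, tr_scalar_mx, mulmx0, mul0mx, mulmx1, addr0, add0r).
    by rewrite -scalar_mxM mulrNN mul1r -scalar_mx_block.
  move=> f mf f0; rewrite (ge0_integral_gamS (measurable_comp_affmap 0 _ mf) (fun t => f0 _)).
  rewrite ge0_integral_gamS//.
  have mF := measurable_fun_fubini_tonelli_F (m2 := gam R d) _
    (measurableT_comp mf (@measurable_cons_pair R d)) (fun z => f0 _).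
  rewrite -[RHS](ge0_integral_stdnormalN mF (fun x => integral_ge0 _ (fun t _ => f0 _))).
  apply: eq_integral => x _; apply: eq_integral => t _; congr f.
  rewrite /affmap add0r col_of_tuple_cons (mul_block_col (-1)%:M).
  rewrite !mul0mx mul1mx addr0 add0r -scalar_mxM mulN1r.
  by rewrite tuple_of_col_cons col_of_tupleK.
have MTM : M^T *m M = 1%:M by case: gM => /mulmx1C.
have c0 : c != 0.
  apply: contra vw0 => /eqP c0; rewrite -[v - w]mul1mx -MTM -mulmxA Mc c0.
  by rewrite raddf0 [X in _ *m X](@col_mx0 R 1 d 1) mulmx0.
have fix_orth (u : 'cV[R]_(1 + d)) : (v - w)^T *m u = 0 -> M^T *m D *m M *m u = u.
  move=> vwu.
  have Mu0 : usubmx (M *m u : 'cV[R]_(1 + d)) = 0.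
    have : (M *m (v - w))^T *m (M *m u) = 0.
      by rewrite trmx_mul mulmxA -(mulmxA _ M^T) MTM mulmx1.
    rewrite Mc (@tr_col_mx R 1 d 1) trmx0 tr_scalar_mx.
    rewrite -[X in _ *m X](@vsubmxK _ 1 d 1 (M *m u)) => h.
    have /eqP : c *: usubmx (M *m u : 'cV[R]_(1 + d)) = 0.
      by rewrite -mul_scalar_mx -[RHS]h (mul_row_col (c%:M : 'M[R]_1)) mul0mx addr0.
    by rewrite scaler_eq0 (negbTE c0)/= => /eqP.
  rewrite -!mulmxA -[M *m u](@vsubmxK _ 1 d 1 (M *m u)) Mu0 /D (@mul_block_col R 1 d 1 d 1).
  rewrite !mul0mx !mulmx0 mul1mx !addr0 add0r -[X in col_mx X _]Mu0 vsubmxK mulmxA MTM mul1mx//.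
have neg : M^T *m D *m M *m (v - w) = - (v - w).
  rewrite -!mulmxA Mc /D (@mul_block_col R 1 d 1 d 1) !mul0mx mulmx0 -scalar_mxM mulN1r !addr0.
  rewrite (_ : col_mx _ 0 = - (col_mx c%:M 0)); last first.
    by rewrite opp_col_mx oppr0 raddfN.
  by rewrite mulmxN -Mc mulmxA MTM mul1mx.
exists (M^T *m D *m M).
  apply: gauss_orthogonalM => //; apply: gauss_orthogonalM => //.
  exact: gauss_orthogonal_tr.
split=> //.
(* Equal norms make [v + w] orthogonal to [v - w]; it is fixed, and half of the sum and difference
   recovers [v] and [w]. *)
have sumfix : M^T *m D *m M *m (v + w) = v + w.
  apply: fix_orth; rewrite linearB /= mulmxBl !mulmxDr vw.
  have -> : w^T *m v = v^T *m w.
    by apply/matrixP => i j; rewrite !ord1 !mxE; apply: eq_bigr => k _; rewrite !mxE mulrC.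
  by rewrite [X in _ - X]addrC subrr.
have half (u : 'cV[R]_d.+1) : 2^-1 *: (u + u) = u.
  by rewrite -{1 2}[u]scale1r -scalerDl scalerA (_ : 2^-1 * _ = 1) ?scale1r//; field.
have v2 : v = 2^-1 *: ((v + w) + (v - w)).
  by rewrite addrACA subrr addr0 half.
have w2 : w = 2^-1 *: ((v + w) - (v - w)).
  by rewrite opprB [v + w]addrC addrACA subrr addr0 half.
by rewrite {1}v2 -scalemxAr mulmxDr sumfix neg -w2.
Qed.
End orthogonal_invariance.

(** * Gaussian laws and their covariance factors *)

Section gaussian_law.
Variable R : realType.

(** Rows are matched one at a time. The reflection that sends the next row of A Q to that of [B]
    fixes the rows already matched, because their inner products with both are the same Gram entry
    and so they are orthogonal to the difference. *)
Lemma gram_orthogonal p d (A B : 'M[R]_(p, d)) : A *m A^T = B *m B^T ->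
  exists2 Q, gauss_orthogonal Q & A *m Q = B.
Proof.
move=> AB.
suff main k : (k <= p)%N -> exists2 Q, gauss_orthogonal Q &
    forall j : 'I_p, (j < k)%N -> row j (A *m Q) = row j B.
  have [Q gQ QB] := main p (leqnn p).
  by exists Q => //; apply/row_matrixP => j; exact: QB.
elim: k => [_|k IH kp]; first by exists 1%:M => //; exact: gauss_orthogonal1.
have [Q gQ QB] := IH (ltnW kp).
pose A' := A *m Q.
have A'B : A' *m A'^T = B *m B^T.
  by case: gQ => QQ _; rewrite trmx_mul mulmxA -(mulmxA A) QQ mulmx1.
have rowE (C : 'M[R]_(p, d)) i j : row i C *m (row j C)^T = (((C *m C^T) i j)%:M : 'M[R]_1).
  apply/matrixP => x y; rewrite !ord1 !mxE mulr1n.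
  by apply: eq_bigr => l _; rewrite !mxE.
pose i0 := Ordinal kp.
have [|M gM [Mv Mfix]] := @gauss_orthogonal_reflection R d (row i0 A')^T (row i0 B)^T.
  by rewrite !trmxK !rowE A'B.
exists (Q *m M^T).
  by apply: gauss_orthogonalM => //; exact: gauss_orthogonal_tr.
have rowM j : row j (A *m (Q *m M^T)) = (M *m (row j A')^T)^T.
  by rewrite trmx_mul trmxK mulmxA row_mul.
move=> j; rewrite ltnS leq_eqVlt => /orP[/eqP jk|jk].
  have -> : j = i0 by exact/val_inj.
  by rewrite rowM Mv trmxK.
have A'j : row j A' = row j B by rewrite QB.
rewrite rowM Mfix ?trmxK//.
by rewrite linearB /= !trmxK mulmxBl rowE A'j rowE A'B subrr.
Qed.

Lemma measurable_affmap_preimage d p v (A : 'M[R]_(p, d)) (C : set (p.-tuple R)) :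
  measurable C -> measurable [set t | C (affmap v A t)].
Proof.
move=> mC; rewrite -[X in measurable X]setTI.
exact: (measurable_affmap v A).
Qed.

Lemma gam_gram d p v (A B : 'M[R]_(p, d)) (C : set (p.-tuple R)) :
  A *m A^T = B *m B^T -> measurable C ->
  gam R d [set t | C (affmap v A t)] = gam R d [set t | C (affmap v B t)].
Proof.
move=> /gram_orthogonal[Q [_ gQ] <-] mC.
have mA := measurable_affmap_preimage v A mC.
have mAQ := measurable_affmap_preimage v (A *m Q) mC.
transitivity (\int[gam R d]_t (\1_[set t | C (affmap v A t)] t)%:E)%E.
  by rewrite integral_indic// setIT.
transitivity (\int[gam R d]_t (\1_[set t | C (affmap v (A *m Q) t)] t)%:E)%E; last first.
  by rewrite integral_indic// setIT.
have mi : measurable_fun setT (fun t => (\1_[set t | C (affmap v A t)] t)%:E : \bar R).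
  exact/measurable_EFinP/measurable_indic.
have i0 t : (0 <= (\1_[set t | C (affmap v A t)] t)%:E :> \bar R)%E by rewrite lee_fin.
rewrite -(gQ _ mi i0).
apply: eq_integral => t _; congr EFin; rewrite !indicE.
congr (nat_of_bool _)%:R; apply/idP/idP; rewrite !inE /=;
  by rewrite /affmap add0r tuple_of_colK mulmxA.
Qed.

Lemma independent_stdnormal_law d (dY : measure_display)
    (OmY : measurableType dY) (Q : probability OmY R) (Y : 'I_d -> {RV Q >-> R}) :
  mutually_independent Y ->
  (forall i (B : set R), measurable B -> distribution Q (Y i) B = normal_prob 0 1 B) ->
  forall C : set (d.-tuple R), measurable C ->
    Q [set w | C [tuple Y j w | j < d]] = gam R d C.
Proof.
move=> iY nY C mC.
have mY : measurable_fun setT (fun w => [tuple Y j w | j < d]).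
  apply/measurable_fun_tnthP => i.
  rewrite (_ : _ \o _ = Y i)//.
  by apply/funext => w /=; rewrite tnth_mktuple.
pose m : {measure set (d.-tuple R) -> \bar R} :=
  pushforward Q (fun w => [tuple Y j w | j < d]).
apply: (@orthant_unique R d (m mY) (gam R d)) mC => [z|]; last first.
  by rewrite /m /= /pushforward preimage_setT probability_setT ltry.
have mz (i : 'I_d) : measurable [set` `]-oo, z i 0]] by exact: measurable_itv.
transitivity (Q [set w | forall i, [set` `]-oo, z i 0]] (Y i w)]).
  rewrite /m /= /pushforward; congr (Q _); apply/seteqP; split => w h i; have := h i;
    by rewrite /= in_itv/= !mxE tnth_mktuple.
rewrite [LHS](iY (fun i => [set` `]-oo, z i 0]]) mz).
transitivity (gam R d [set t | forall i : 'I_d, [set` `]-oo, z i 0]] (tnth t i)]).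
  rewrite (gam_rect (A := fun i => [set` `]-oo, z i 0]]))//.
  by apply: eq_bigr => i _; exact: nY.
by congr (gam R d _); apply/seteqP; split => t h i; have := h i; rewrite /= in_itv/= !mxE.
Qed.

(** The definition of [gaussian] supplies some factor of [S]; as the image law depends on the Gram
    matrix only, it can be traded for any other one, in particular a rotated one. *)
Lemma gaussian_law d (mu : 'cV[R]_d) (S : 'M[R]_d) (dO : measure_display)
    (Om : measurableType dO) (P : probability Om R) (X : {RV P >-> d.-tuple R}) :
  gaussian mu S X -> forall A : 'M[R]_d, A *m A^T = S ->
  forall C : set (d.-tuple R), measurable C ->
    distribution P X C = gam R d [set t | C (affmap mu A t)].
Proof.
move=> [A0 [A0S [dY [OmY [Q [Y [iY nY XY]]]]]]] A AS C mC.
rewrite XY// (gam_gram mu (B := A0))//; last by rewrite AS A0S.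
rewrite -(independent_stdnormal_law iY nY); last exact: measurable_affmap_preimage.
congr (Q _); apply/seteqP; split => w /=;
  rewrite /affmap (_ : col_of_tuple _ = \col_j Y j w)//;
  by apply/colP => j; rewrite !mxE tnth_mktuple.
Qed.

Lemma gaussian_of_gam d (mu : 'cV[R]_d) (A : 'M[R]_d) (dO : measure_display)
    (Om : measurableType dO) (P : probability Om R) (X : {RV P >-> d.-tuple R}) :
  (forall C : set (d.-tuple R), measurable C ->
    distribution P X C = gam R d [set t | C (affmap mu A t)]) ->
  gaussian mu (A *m A^T) X.
Proof.
move=> XA; exists A; split => //.
exists _, _, (gam R d).
pose Y (i : 'I_d) : {RV gam R d >-> R} :=
  HB.pack (fun t : d.-tuple R => tnth t i)
    (isMeasurableFun.Build _ _ _ _ (fun t : d.-tuple R => tnth t i) (measurable_tnth i)).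
have rect (B : 'I_d -> set R) : (forall i, measurable (B i)) ->
    (gam R d [set t | forall i, B i (tnth t i)] =
     \prod_(i < d) gam R d (Y i @^-1` B i))%E.
  move=> mB; rewrite (gam_rect mB); apply: eq_bigr => i _.
  have -> : Y i @^-1` B i = [set t : d.-tuple R | forall j, (if j == i then B i else setT) (tnth t j)].
    apply/seteqP; split => t /=; last by move=> /(_ i); rewrite eqxx.
    by move=> h j; case: eqVneq => [->|].
  rewrite (gam_rect (A := fun j => if j == i then B i else setT)); last first.
    by move=> j; case: ifP.
  rewrite (bigD1 i)//= eqxx big1 ?mule1// => j /negbTE ->.
  exact: probability_setT.
exists Y; split.
- by move=> B mB; exact: rect.
- move=> i B mB; rewrite /distribution /pushforward.
  have -> : Y i @^-1` B = [set t : d.-tuple R | forall j, (if j == i then B else setT) (tnth t j)].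
    apply/seteqP; split => t /=; last by move=> /(_ i); rewrite eqxx.
    by move=> h j; case: eqVneq => [->|].
  rewrite (gam_rect (A := fun j => if j == i then B else setT)); last first.
    by move=> j; case: ifP.
  rewrite (bigD1 i)//= eqxx big1 ?mule1// => j /negbTE ->.
  exact: probability_setT.
- move=> B mB; rewrite XA//; congr (gam R d _); apply/seteqP; split => t /=;
  rewrite /affmap (_ : col_of_tuple _ = \col_j tnth t j)//.
Qed.

(** The sum of the coordinates of A' t has coefficient vector A'^T 1; turning that vector to the
    first axis reduces the sum to c t_0. *)
Lemma axis_factor d (A : 'M[R]_(1 + d)) :
  exists2 A' : 'M[R]_(1 + d), A' *m A'^T = A *m A^T &
    exists c, A'^T *m const_mx 1 = col_mx c%:M 0 :> 'cV[R]_(1 + d).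
Proof.
have [M [MM _] [c Mc]] := gauss_orthogonal_to_axis (A^T *m const_mx 1).
exists (A *m M^T).
  by rewrite trmx_mul trmxK mulmxA -(mulmxA A) (mulmx1C MM) mulmx1.
by exists c; rewrite trmx_mul trmxK -mulmxA.
Qed.

End gaussian_law.

(** * Limits of sequences *)

Section sequences.
Variable R : realType.

Lemma increasing_seq_comp (f g : nat -> nat) :
  increasing_seq f -> increasing_seq g -> increasing_seq (f \o g).
Proof. by move=> hf hg m n; rewrite /= hf -leEnat hg. Qed.

Lemma increasing_seq_cvg_infty (f : nat -> nat) : increasing_seq f -> f @ \oo --> \oo.
Proof.
move=> fi; have nf n : (n <= f n)%N.
  elim: n => // n IH; apply: leq_ltn_trans IH _.
  rewrite ltnNge; apply/negP => h.
  have := fi n.+1 n; rewrite leEnat h ltnn.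
  by [].
move=> A [N _ hN]; exists N => // n /= Nn; apply: hN => /=.
exact: leq_trans Nn (nf n).
Qed.

Lemma bounded_fun_comp (u : nat -> R) (f : nat -> nat) :
  bounded_fun u -> bounded_fun (u \o f).
Proof.
case=> M [Mr hM]; exists M; split => // x /hM h n _; exact: h.
Qed.

Lemma cvg_subseq_finite (I : finType) (u : I -> nat -> R) :
  (forall i, bounded_fun (u i)) ->
  exists2 f : nat -> nat, increasing_seq f & forall i, cvgn (u i \o f).
Proof.
move=> bu.
suff main (s : seq I) : exists2 f : nat -> nat, increasing_seq f &
    forall i, i \in s -> cvgn (u i \o f).
  have [f fi fu] := main (enum I); exists f => // i; apply: fu.
  by rewrite mem_enum.
elim: s => [|i s [f fi fu]]; first by exists id.
have [g gi gu] := bolzano_weierstrass (bounded_fun_comp f (bu i)).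
exists (f \o g); first exact: increasing_seq_comp.
move=> j; rewrite inE => /predU1P[->//|/fu uf].
apply/cvg_ex; exists (limn (u j \o f)).
exact: (cvg_comp _ _ (increasing_seq_cvg_infty gi) uf).
Qed.

(** A squeeze from exp(- p / (1 - p)) <= 1 - p <= exp(- p), raised to the power N; p tends to 0
    because N p converges while N diverges. *)
Lemma cvg_expR_power (N : nat -> nat) (p : nat -> R) (L : R) :
  (forall k, 0 <= p k <= 1) ->
  ((N k)%:R : R) @[k --> \oo] --> +oo ->
  ((N k)%:R * p k) @[k --> \oo] --> L ->
  ((1 - p k) ^+ N k) @[k --> \oo] --> expR (- L).
Proof.
move=> p01 Noo NpL.
have N0 : \forall k \near \oo, 0 < ((N k)%:R : R).
  by move/cvgryPgt : Noo => /(_ 0).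
have Ninv : ((N k)%:R^-1 : R) @[k --> \oo] --> 0 by apply/gtr0_cvgV0.
have p0 : p k @[k --> \oo] --> 0.
  rewrite -(mul0r L).
  apply: cvg_trans (cvgM Ninv NpL).
  apply: near_eq_cvg; near=> k.
  by rewrite /= mulrA mulVf ?mul1r// gt_eqF//; near: k.
have q1 : (1 - p k) @[k --> \oo] --> (1 : R).
  by rewrite -[X in _ --> X]subr0; apply: cvgB => //; exact: cvg_cst.
apply: (@squeeze_cvgr _ _ _ _ (fun k => expR (- ((N k)%:R * p k / (1 - p k))))
  (fun k => expR (- ((N k)%:R * p k)))).
- near=> k.
  have pk1 : 0 < 1 - p k.
    by near: k; move/cvgrPdist_lt : q1 => /(_ 1 ltr01); apply: filterS => k; rewrite ltr_norml; lra.
  have [pk0 _] := andP (p01 k).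
  apply/andP; split.
    rewrite -mulrA -mulrN mulrC expRM_natr; apply: lerXn2r; rewrite ?nnegrE ?expR_ge0 ?(ltW pk1)//.
    rewrite expRN -[leRHS]invrK lef_pV2 ?posrE ?invr_gt0 ?expR_gt0//.
    apply: le_trans (expR_ge1Dx _).
    rewrite le_eqVlt; apply/orP; left; apply/eqP; field; exact: lt0r_neq0.
  rewrite -mulrN mulrC expRM_natr; apply: lerXn2r; rewrite ?nnegrE ?expR_ge0 ?(ltW pk1)//.
  exact: expR_ge1Dx.
- apply: (continuous_cvg _ (@continuous_expR R _)); apply: cvgN.
  rewrite -[L]divr1; apply: cvgM => //; exact: cvgV.
- by apply: (continuous_cvg _ (@continuous_expR R _)); exact: cvgN.
Unshelve. all: by end_near.
Qed.

Lemma cvg_sumr (I : Type) (s : seq I) (f : I -> nat -> R) (l : I -> R) :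
  (forall i, f i n @[n --> \oo] --> l i) ->
  \sum_(i <- s) f i n @[n --> \oo] --> \sum_(i <- s) l i.
Proof.
move=> fl; elim: s => [|i s IH].
  by rewrite big_nil; under eq_fun do rewrite big_nil; exact: cvg_cst.
by rewrite big_cons; under eq_fun do rewrite big_cons; exact: cvgD.
Qed.

End sequences.

(** * Growth of the normalizing constants *)

Section normalizing_constants.
Variables (R : realType) (b : nat -> R).
Hypothesis bE : forall n, (0 < n)%N -> b n = n%:R * normal_pdf 0 1 (b n).

Let peak_gt0 : 0 < normal_peak (1 : R).
Proof. by rewrite normal_peak_gt0// oner_eq0. Qed.

Let phi_gt0 (x : R) : 0 < normal_pdf 0 1 x.
Proof. by rewrite normal_pdf01E mulr_gt0// expR_gt0. Qed.

Lemma normalizer_gt0 n : (0 < n)%N -> 0 < b n.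
Proof. by move=> n0; rewrite bE// mulr_gt0// ltr0n. Qed.

(** The density decreases on the positive axis, so b_n <= M would give M >= b_n = n phi(b_n) >= n
    phi(M), which fails for large n. *)
Lemma normalizer_cvg : b m.+1 @[m --> \oo] --> +oo.
Proof.
apply/cvgryPge => A; pose M := Num.max A 1.
have M0 : 0 < M by rewrite lt_max ltr01 orbT.
near=> m.
suff : M < b m.+1 by move=> /ltW; apply: le_trans; rewrite le_max lexx.
rewrite ltNge; apply/negP => bM.
have b0 : 0 < b m.+1 by exact: normalizer_gt0.
have : m.+1%:R * normal_pdf 0 1 M <= M.
  apply: (le_trans _ bM); rewrite [leRHS]bE// ler_pM2l ?ltr0n// !normal_pdf01E.
  rewrite ler_pM2l// ler_expR ler_pM2r ?invr_gt0// lerN2.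
  by apply: lerXn2r; rewrite ?nnegrE ?(ltW b0) ?(ltW M0)//.
rewrite -ler_pdivlMr//; apply/negP; rewrite -ltNge.
near: m; apply: filterS (nbhs_infty_gtr (M / normal_pdf 0 1 M)) => m h.
by apply: lt_le_trans h _; rewrite ler_nat.
Unshelve. all: by end_near. Qed.

Lemma normalizer_inv_cvg : (b m.+1)^-1 @[m --> \oo] --> 0.
Proof.
apply/gtr0_cvgV0; last exact: normalizer_cvg.
by apply: nearW => m; exact: normalizer_gt0.
Qed.

(** The logarithm of b = n phi(b) reads log n = log b - log phi(0) + b^2 / 2, and log b is
    negligible against b^2. *)
Lemma normalizer_log : (ln m.+1%:R / (b m.+1) ^+ 2) @[m --> \oo] --> (2^-1 : R).
Proof.
have bi := normalizer_inv_cvg.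
have bi2 : ((b m.+1)^-1 ^+ 2) @[m --> \oo] --> (0 : R).
  by rewrite -(mulr0 (0 : R)); exact: (cvgM bi bi).
have lnb : (ln (b m.+1) * (b m.+1)^-1 ^+ 2) @[m --> \oo] --> (0 : R).
  apply: (@squeeze_cvgr _ _ _ _ (fun=> 0) (fun m => (b m.+1)^-1)) => //; last exact: cvg_cst.
  near=> m.
  have b1 : 1 <= b m.+1 by near: m; move/cvgryPge : normalizer_cvg; apply.
  have b0 : 0 < b m.+1 by exact: lt_le_trans b1.
  apply/andP; split; first by rewrite mulr_ge0 ?ln_ge0// exprn_ge0// invr_ge0 ltW.
  rewrite expr2 mulrA -[leRHS]mul1r ler_pM2r ?invr_gt0// ler_pdivrMr// mul1r.
  exact/ltW/ln_sublinear.
suff -> : (fun m => ln m.+1%:R / (b m.+1) ^+ 2) =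
    (fun m => ln (b m.+1) * (b m.+1)^-1 ^+ 2 - ln (normal_peak 1) * (b m.+1)^-1 ^+ 2 + 2^-1).
  rewrite -[X in _ --> X]add0r -[X in _ --> X + _]subr0.
  apply: cvgD; last exact: cvg_cst.
  apply: cvgB => //; rewrite -(mulr0 (ln (normal_peak 1))).
  by apply: cvgMr; exact: bi2.
apply/funext => m.
have b0 : 0 < b m.+1 by exact: normalizer_gt0.
have := congr1 (@ln R) (@bE m.+1 isT).
rewrite normal_pdf01E !lnM ?posrE ?mulr_gt0 ?ltr0n ?expR_gt0// expRK => lb.
have -> : ln m.+1%:R = ln (b m.+1) - ln (normal_peak 1) + (b m.+1)^+2 / 2 by rewrite lb; field.
by field; exact: lt0r_neq0.
Unshelve. all: by end_near. Qed.

End normalizing_constants.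

(** * Exponential moments for the dominating function *)

Section integrability.
Variable R : realType.

Lemma integral_exp_abs_stdnormal (K : R) :
  (\int[@stdnormal R]_x (expR (K * `|x|))%:E < +oo)%E.
Proof.
have mK (a : R) : measurable_fun [set: R] (fun x : R => (expR (a * x))%:E : \bar R).
  by apply/measurable_EFinP; apply: measurableT_comp => //; exact: measurable_funM.
(* Completing the square: exp(a x) times the N(0, 1) density is exp(a^2 / 2) times the N(a, 1)
   density. *)
have mgf (a : R) : (\int[@stdnormal R]_x (expR (a * x))%:E = (expR (a ^+ 2 / 2))%:E)%E.
  rewrite ge0_integral_stdnormal//.
  rewrite -[RHS]mule1 -(integral_normal_pdf a 1) -integral_leb; first last.
  - by move=> x; rewrite lee_fin normal_pdf_ge0.
  - by apply/measurable_EFinP; exact: measurable_normal_pdf.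
  rewrite -ge0_integralZl//; first last.
  - by move=> x _; rewrite lee_fin normal_pdf_ge0.
  - by apply/measurable_EFinP; exact: measurable_normal_pdf.
  apply: eq_integral => x _; rewrite -!EFinM; congr EFin.
  rewrite !normal_pdfE ?oner_eq0// /normal_fun.
  rewrite mulrCA [RHS]mulrCA -!expRD subr0 expr1n.
  by congr (_ * expR _); field.
have step : (\int[@stdnormal R]_x (expR (K * `|x|))%:E <=
    \int[@stdnormal R]_x ((expR (K * x))%:E + (expR (- K * x))%:E))%E.
  apply: ge0_le_integral => //.
  - apply/measurable_EFinP; apply: measurableT_comp => //; apply: measurable_funM => //.
  - by apply: emeasurable_funD.
  - move=> x _; rewrite -EFinD lee_fin.
    have [x0|x0] := leP 0 x; first by rewrite ger0_norm// lerDl expR_ge0.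
    by rewrite ltr0_norm// mulNr mulrN lerDr expR_ge0.
apply: le_lt_trans step _.
rewrite ge0_integralD//; try by move=> x _; rewrite lee_fin expR_ge0.
by rewrite !mgf -EFinD ltry.
Qed.

Lemma measurable_sum_abs d : measurable_fun [set: d.-tuple R] (fun t => \sum_i `|tnth t i|).
Proof.
apply: measurable_sum => i; apply: measurableT_comp => //; exact: measurable_tnth.
Qed.

Lemma integral_exp_sum_abs_gam d (K : R) :
  (\int[gam R d]_t (expR (K * \sum_i `|tnth t i|))%:E < +oo)%E.
Proof.
have mexp n : measurable_fun [set: n.-tuple R]
    (fun t => (expR (K * \sum_i `|tnth t i|))%:E : \bar R).
  apply/measurable_EFinP; apply: measurableT_comp => //; apply: measurable_funM => //.
  exact: measurable_sum_abs.
elim: d => [|d IH].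
  rewrite /= integral_dirac//; last exact: mexp.
  by rewrite diracT mul1e ltry.
rewrite ge0_integral_gamS//.
have -> : (\int[@stdnormal R]_x \int[gam R d]_t
    (expR (K * (\sum_i `|tnth (cons_pair (x, t)) i|)))%:E =
  \int[@stdnormal R]_x ((expR (K * `|x|))%:E *
     \int[gam R d]_t (expR (K * (\sum_i `|tnth t i|)))%:E))%E.
  apply: eq_integral => x _.
  rewrite -ge0_integralZl//; last exact: mexp.
  apply: eq_integral => t _; rewrite -EFinM -expRD -mulrDr big_ord_recl; congr (expR (_ * (_ + _)))%:E.
  by apply: eq_bigr => i _; rewrite tnthS.
rewrite ge0_integralZr//.
- by rewrite lte_mul_pinfty//; [exact: integral_ge0 => x _; rewrite lee_fin expR_ge0|
   rewrite ge0_fin_numE ?integral_exp_abs_stdnormal//; apply: integral_ge0 => x _; rewrite lee_fin expR_ge0].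
- apply/measurable_EFinP; apply: measurableT_comp => //; exact: measurable_funM.
- by apply: integral_ge0 => x _; rewrite lee_fin expR_ge0.
Qed.

Lemma integral_exp_neg_half_abs :
  (\int[@leb R]_s (expR (- (`|s| / 2)))%:E < +oo)%E.
Proof.
(* Twice the exponential density of rate 1/2 is exp(- s / 2) for s >= 0; adding its mirror image
   covers the negative axis. *)
pose pdf (s : R) := exponential_pdf 2^-1 s.
have mpdf : measurable_fun [set: R] (fun s : R => (pdf s)%:E : \bar R).
  by apply/measurable_EFinP; exact: measurable_exponential_pdf.
have mpdfN : measurable_fun [set: R] (fun s : R => (pdf (- s))%:E : \bar R).
  exact: (measurableT_comp mpdf).
have h2 : 0 < (2^-1 : R) by rewrite invr_gt0.
have pdf0 s : (0 <= (pdf s)%:E :> \bar R)%E by rewrite lee_fin exponential_pdf_ge0// ltW.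
have I1 : (\int[@leb R]_s (pdf s)%:E = 1)%E.
  by rewrite integral_leb// integral_exponential_pdf.
have I2 : (\int[@leb R]_s (pdf (- s)%R)%:E = 1)%E.
  rewrite -I1 [RHS](@ge0_integral_affine R (-1) 0)//.
  by rewrite normrN1 mul1e; under [RHS]eq_integral do rewrite mulN1r addr0.
apply: (@le_lt_trans _ _ (2%:E * \int[@leb R]_s ((pdf s)%:E + (pdf (- s)%R)%:E))%E).
  rewrite -ge0_integralZl//; first last.
  - by move=> s _; rewrite adde_ge0.
  - exact: emeasurable_funD.
  apply: ge0_le_integral => //.
  - apply/measurable_EFinP; apply: measurableT_comp => //; apply: measurableT_comp => //.
    by apply: measurable_funM => //; exact: measurableT_comp.
  - by apply: emeasurable_funM => //; exact: emeasurable_funD.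
  - move=> s _; rewrite -EFinD -EFinM lee_fin.
    have pdfE x : 0 <= x -> 2 * pdf x = expR (- (x / 2)).
      move=> x0; rewrite /pdf exponential_pdfE// mulrA divff// mul1r.
      by congr expR; field.
    have pdf0' x : 0 <= 2 * pdf x by rewrite mulr_ge0// exponential_pdf_ge0// ltW.
    have [s0|s0] := leP 0 s; first by rewrite ger0_norm// mulrDr pdfE// lerDl.
    by rewrite ltr0_norm// mulrDr [X in _ + X]pdfE ?lerDr// oppr_ge0 ltW.
by rewrite ge0_integralD// I1 I2 -EFinD -EFinM ltry.
Qed.

End integrability.

(** * Exceedances of high levels *)

Section exceedance.
Variable R : realType.

(** For z = (s, t), the rescaled height of component k when the mean coordinate is at b + s / b and
    the other normal variables are t: drift, slope times s, and residual. *)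
Definition level d p (mu u : 'cV[R]_p) (B : 'M[R]_(p, d)) (z : R * d.-tuple R)
  (k : 'I_p) : R := mu k 0 + u k 0 * z.1 + \sum_j B k j * tnth z.2 j.

Definition exceed d p (x mu u : 'cV[R]_p) (B : 'M[R]_(p, d)) : set (R * d.-tuple R) :=
  [set z | exists k, x k 0 < level mu u B z k].

Lemma measurable_level d p mu u (B : 'M[R]_(p, d)) k :
  measurable_fun setT (fun z => level mu u B z k).
Proof.
apply: measurable_funD.
  by apply: measurable_funD => //; apply: measurable_funM.
apply: measurable_sum => j; apply: measurable_funM => //.
by apply: (measurableT_comp (measurable_tnth j)).
Qed.

Lemma measurable_exceed d p x mu u (B : 'M[R]_(p, d)) : measurable (exceed x mu u B).
Proof.
rewrite (_ : exceed x mu u B =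
    \bigcup_(k in [set: 'I_p]) ((fun z => level mu u B z k) @^-1` `]x k 0, +oo[)).
  apply: fin_bigcup_measurable => // k _; rewrite -[X in measurable X]setTI.
  exact: (measurable_level mu u B k).
apply/seteqP; split => z /=; first by move=> [k xk]; exists k => //=; rewrite in_itv/= xk.
by move=> [k _ /=]; rewrite in_itv/= andbT => xk; exists k.
Qed.

(* With [r = 1 / |tau|], [w = b ^ 2 (tau ^ -2 - 1)], [q = tau ^ -2] and
   [e = tau ^ -2 / (2 b ^ 2)] this is [n phi ((b + s / b) / tau) / (b |tau|)]
   when [b = n phi b]. *)
Definition weight (r w q e s : R) : R := r * expR (- w / 2 - q * s - e * s ^+ 2).

Lemma measurable_weight r w q e : measurable_fun [set: R] (weight r w q e).
Proof.
apply: measurable_funM => //; apply: measurableT_comp => //.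
apply: measurable_funB.
  by apply: measurable_funB => //; exact: measurable_funM.
by apply: measurable_funM => //; exact: measurable_funX.
Qed.

Lemma integrable_exp_abs d (C K : R) : 0 <= C ->
  (@leb R \x gam R d)%E.-integrable setT
    (fun z => (C * expR (- (`|z.1| / 2)) * expR (K * \sum_i `|tnth z.2 i|))%:E).
Proof.
move=> C0.
have m1 : measurable_fun [set: R] (fun s : R => expR (- (`|s| / 2))).
  apply: measurableT_comp => //; apply: measurableT_comp => //.
  by apply: measurable_funM => //; exact: measurableT_comp.
have m2 : measurable_fun [set: d.-tuple R] (fun t => expR (K * \sum_i `|tnth t i|)).
  apply: measurableT_comp => //; apply: measurable_funM => //.
  exact: measurable_sum_abs.
apply/integrable12ltyP.
  apply/measurable_EFinP; apply: measurable_funM.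
    by apply: measurable_funM => //; exact: (measurableT_comp m1 measurable_fst).
  exact: (measurableT_comp m2 measurable_snd).
rewrite (eq_integral (fun s : R => (C%:E * (expR (- (`|s| / 2)))%:E) *
    \int[gam R d]_t (expR (K * \sum_i `|tnth t i|))%:E)%E); last first.
  move=> s _; rewrite -ge0_integralZl//.
  - apply: eq_integral => t _; rewrite -!EFinM /= ger0_norm//.
    by rewrite mulr_ge0 ?expR_ge0// mulr_ge0 ?expR_ge0.
  - exact/measurable_EFinP.
  - by rewrite mule_ge0// lee_fin ?expR_ge0.
rewrite ge0_integralZr//.
- apply: lte_mul_pinfty.
  + by apply: integral_ge0 => s _; rewrite mule_ge0 ?lee_fin ?expR_ge0.
  + rewrite ge0_fin_numE; last by apply: integral_ge0 => s _; rewrite mule_ge0 ?lee_fin ?expR_ge0.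
    rewrite ge0_integralZl//; last exact/measurable_EFinP.
    apply: lte_mul_pinfty => //; exact: integral_exp_neg_half_abs.
  + exact: integral_exp_sum_abs_gam.
- by apply: emeasurable_funM => //; exact/measurable_EFinP.
- by move=> s _; rewrite mule_ge0 ?lee_fin ?expR_ge0.
- by apply: integral_ge0 => t _; rewrite lee_fin expR_ge0.
Qed.

(** The slope in s is 1, so for fixed t only finitely many s put some component on its threshold.
    The Lebesgue variable alone does this, whatever the rank of [B]. *)
Lemma level_boundary_negligible d p (x mu : 'cV[R]_p) (B : 'M[R]_(p, d)) :
  (@leb R \x gam R d)%E.-negligible
    [set z | exists k, level mu (const_mx 1) B z k = x k 0].
Proof.
set N := [set z | _].
have mN : measurable N.
  rewrite (_ : N = \bigcup_(k in [set: 'I_p])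
      ((fun z => level mu (const_mx 1) B z k) @^-1` [set x k 0])).
    apply: fin_bigcup_measurable => // k _; rewrite -[X in measurable X]setTI.
    exact: (measurable_level mu (const_mx 1) B k).
  by apply/seteqP; split => z /=; [move=> [k xk]; exists k|move=> [k _ /=]; exists k].
exists N; split => //.
transitivity (\int[@leb R \x gam R d]_z (\1_N z)%:E)%E.
  by rewrite integral_indic// setIT.
rewrite fubini_tonelli2//; last by apply/measurable_EFinP; exact: measurable_indic.
apply: integral0_eq => t _.
have mNt : measurable [set s | N (s, t)].
  rewrite -[X in measurable X]setTI.
  have mp : measurable_fun [set: R] (fun s => (s, t)) by exact: measurable_fun_pair.
  exact: (mp measurableT _ mN).
transitivity (\int[@leb R]_s (\1_[set s | N (s, t)] s)%:E)%E => //.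
rewrite integral_indic// setIT.
apply: countable_lebesgue_measure0; apply: finite_set_countable.
apply: (@sub_finite_set _ _ ((fun k => x k 0 - mu k 0 - \sum_j B k j * tnth t j) @` [set: 'I_p])).
  move=> s /= [k]; rewrite /level mxE mul1r /= => h; exists k => //.
  by rewrite -h; ring.
exact: finite_image.
Qed.

Lemma exceed_dct d p (x mu : 'cV[R]_p) (B : 'M[R]_(p, d)) (w : R)
    (r_ w_ q_ e_ : nat -> R) (mu_ u_ : nat -> 'cV[R]_p) (B_ : nat -> 'M[R]_(p, d)) :
  r_ n @[n --> \oo] --> (1 : R) -> w_ n @[n --> \oo] --> w ->
  q_ n @[n --> \oo] --> (1 : R) -> e_ n @[n --> \oo] --> (0 : R) ->
  (forall n, 0 <= r_ n) -> (forall n, 0 <= e_ n) ->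
  (forall k, mu_ n k 0 @[n --> \oo] --> mu k 0) ->
  (forall k, u_ n k 0 @[n --> \oo] --> (1 : R)) ->
  (forall k j, B_ n k j @[n --> \oo] --> B k j) ->
  let f := fun z => (weight 1 w 1 0 z.1 * \1_(exceed x mu (const_mx 1) B) z)%:E in
  (@leb R \x gam R d)%E.-integrable setT f /\
  (\int[@leb R \x gam R d]_z
     (weight (r_ n) (w_ n) (q_ n) (e_ n) z.1 * \1_(exceed x (mu_ n) (u_ n) (B_ n)) z)%:E)%E
    @[n --> \oo] --> (\int[@leb R \x gam R d]_z f z)%E.
Proof.
move=> r1 w1 q1 e1 r0 e0 mu1 u1 B1 f.
pose W := `|w| / 2 + 1.
pose C0 := \sum_k `|mu k 0 + 1 - x k 0|.
pose K := \sum_k \sum_j `|B k j| + 1.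
have C0_ge k : mu k 0 + 1 - x k 0 <= C0.
  apply: le_trans (ler_norm _) _.
  by rewrite /C0 (bigD1 k)//= lerDl sumr_ge0.
have K_ge k j : `|B k j| + 1 <= K.
  rewrite lerD2r (bigD1 k)//= (bigD1 j)//= -addrA lerDl addr_ge0// sumr_ge0//.
  by move=> i _; rewrite sumr_ge0.
have ev : \forall n \near \oo,
    [/\ r_ n <= 2, - w_ n / 2 <= W & 2^-1 <= q_ n <= 2] /\
    [/\ (forall k, 7 / 8 <= u_ n k 0), (forall k, mu_ n k 0 - x k 0 <= C0) &
        forall k j, `|B_ n k j| <= K].
  near=> n; split; split.
  - by near: n; apply: (cvgr_le _ r1); rewrite ltr1n.
  - have h : `|w_ n| <= `|w| + 2 by near: n; apply: (cvgr_norm_le _ w1); rewrite ltrDl.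
    have := ler_norm (- w_ n); rewrite normrN /W; lra.
  - apply/andP; split; near: n.
      by apply: (cvgr_ge _ q1); rewrite invf_lt1// ltr1n.
    by apply: (cvgr_le _ q1); rewrite ltr1n.
  - near: n; apply: filter_forall => k; apply: (cvgr_ge _ (u1 k)); lra.
  - have h : forall k, mu_ n k 0 <= mu k 0 + 1.
      by near: n; apply: filter_forall => k; apply: (cvgr_le _ (mu1 k)); rewrite ltrDl.
    move=> k; have := h k; have := C0_ge k; lra.
  - have h : forall k j, `|B_ n k j| <= `|B k j| + 1.
      near: n; apply: filter_forall => k; apply: filter_forall => j.
      by apply: (cvgr_norm_le _ (B1 k j)); rewrite ltrDl.
    by move=> k j; apply: le_trans (h k j) _.
case: ev => N _ hN.
pose g n z := (weight (r_ n) (w_ n) (q_ n) (e_ n) z.1 * \1_(exceed x (mu_ n) (u_ n) (B_ n)) z)%:E.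
(* The factor 2 bounds [r_ n] and [W] bounds - w_n / 2. For s >= 0 the decay exp(- s / 2) comes from
   q_n >= 1/2; for s < 0 it has to come from the exceedance itself. *)
pose H (z : R * d.-tuple R) := (2 * expR (W + 4 * C0) * expR (- (`|z.1| / 2)) *
   expR (4 * K * \sum_i `|tnth z.2 i|))%:E.
have mweight r0' w0 q0 e0' x0 mu0 u0 B0 : measurable_fun setT
    (fun z => (weight r0' w0 q0 e0' z.1 * \1_(@exceed d p x0 mu0 u0 B0) z)%:E : \bar R).
  apply/measurable_EFinP; apply: measurable_funM.
    apply: (measurableT_comp (measurable_weight r0' w0 q0 e0')) => //.
  by apply: measurable_indic; exact: measurable_exceed.
have mg n : measurable_fun setT (g n) by exact: mweight.
have mf : measurable_fun setT f by exact: mweight.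
have gf : {ae (@leb R \x gam R d)%E, forall z, setT z -> g ^~ z @ \oo --> f z}.
  apply: (negligibleS _ (level_boundary_negligible x mu B)) => z /= h.
  apply: contrapT => nz; apply: h => _.
  have lev k : level (mu_ n) (u_ n) (B_ n) z k @[n --> \oo] --> level mu (const_mx 1) B z k.
    rewrite /level; apply: cvgD.
      apply: cvgD; first exact: mu1.
      by rewrite mxE; apply: cvgMr_tmp; exact: u1.
    apply: cvg_sumr => j; apply: cvgMr_tmp; exact: B1.
  (* Off the boundary each comparison with the threshold is strict in the limit, hence eventually
     settled, and the indicator is eventually constant. *)
  have same : \forall n \near \oo,
      \1_(exceed x (mu_ n) (u_ n) (B_ n)) z = \1_(exceed x mu (const_mx 1) B) z :> R.
    have : \forall n \near \oo, forall k,
        (x k 0 < level (mu_ n) (u_ n) (B_ n) z k) = (x k 0 < level mu (const_mx 1) B z k).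
      apply: filter_forall => k.
      have [xl|xl|xl] := ltgtP (x k 0) (level mu (const_mx 1) B z k).
      - by apply: filterS (cvgr_gt _ (lev k) _ xl) => n h.
      - apply: filterS (cvgr_lt _ (lev k) _ xl) => n h.
        by apply/negbTE; rewrite -leNgt ltW.
      - by exfalso; apply: nz; exists k.
    apply: filterS => n hk; rewrite !indicE; congr (nat_of_bool _)%:R.
    apply/idP/idP; rewrite !inE => -[k hx]; exists k; move: hx; by rewrite hk.
  apply: cvg_EFin; first exact: nearW.
  apply: cvgM.
    apply: cvgM => //; apply: (continuous_cvg _ (@continuous_expR R _)).
    apply: cvgB; last exact: cvgMr_tmp.
    apply: cvgB; last exact: cvgMr_tmp.
    by apply: cvgMr_tmp; exact: cvgN.
  by apply: cvg_near_cst; apply: filterS same.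
(* For s < 0 an exceedance forces 0 < C0 + 7 s / 8 + K sum |t_i|, so the
   indicator is at most the exponential of 4 times the right-hand side, which
   beats the growth exp(-2 s) of the weight. *)
have gH n z : (N <= n)%N -> (`|g n z| <= H z)%E.
  move=> /hN [[rn wn /andP[qn1 qn2]] [un mun Bn]].
  rewrite /g /H /= lee_fin normrM ger0_norm; last by rewrite mulr_ge0 ?expR_ge0.
  rewrite indicE; case: (boolP (z \in _)) => [|_]; last first.
    by rewrite normr0 mulr0 !mulr_ge0 ?expR_ge0.
  rewrite inE normr1 mulr1 => -[k xk].
  rewrite -!mulrA -!expRD; apply: ler_pM => //.
  rewrite ler_expR.
  set T := \sum_i `|tnth z.2 i|.
  have T0 : 0 <= T by rewrite sumr_ge0.
  have K0 : 0 <= K by rewrite addr_ge0// sumr_ge0// => i _; rewrite sumr_ge0.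
  have C00 : 0 <= C0 by rewrite sumr_ge0.
  have BT : \sum_j B_ n k j * tnth z.2 j <= K * T.
    rewrite mulr_sumr; apply: ler_sum => j _; apply: le_trans (ler_norm _) _.
    by rewrite normrM ler_wpM2r.
  have es : 0 <= e_ n * z.1 ^+ 2 by rewrite mulr_ge0// sqr_ge0.
  have KT : 0 <= K * T by rewrite mulr_ge0.
  have [s0|s0] := leP 0 z.1.
    rewrite ger0_norm//.
    have qs : z.1 / 2 <= q_ n * z.1 by rewrite mulrC ler_wpM2r.
    lra.
  rewrite ltr0_norm//.
  have qs : 2 * z.1 <= q_ n * z.1 by rewrite ler_nM2r.
  have us : u_ n k 0 * z.1 <= 7 / 8 * z.1 by rewrite ler_nM2r.
  have := mun k; move: xk; rewrite /level; lra.
have iH : (@leb R \x gam R d)%E.-integrable setT H.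
  by apply: integrable_exp_abs; rewrite mulr_ge0 ?expR_ge0.
(* The domination holds only from rank [N] on, so the sequence is shifted before the theorem is
   applied. *)
have gfN : {ae (@leb R \x gam R d)%E, forall z, setT z -> (fun n => g (n + N)%N z) @ \oo --> f z}.
  apply: filterS gf => z /= h zT; rewrite (cvg_shiftn N (g ^~ z)); exact: h.
have gHN : {ae (@leb R \x gam R d)%E, forall z n, setT z -> (`|g (n + N)%N z| <= H z)%E}.
  by apply: aeW => z n _; apply: gH; rewrite leq_addl.
have [If _ cf] := dominated_convergence measurableT (fun n => mg (n + N)%N) mf gfN iH gHN.
split=> //.
rewrite -(cvg_shiftn N); exact: cf.
Unshelve. all: by end_near.
Qed.

End exceedance.

(** * Exact integral for the expected number of exceedances *)

Section row_probability.
Variable R : realType.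

Definition threshold d (b : R) (x : 'cV[R]_d) : 'cV[R]_d := \col_k (b + x k 0 / b).

(* Substitute [(b + s / b) / tau] for the first standard normal variable. *)
Lemma row_probability d (A : 'M[R]_(1 + d)) (tau b N : R) (x : 'cV[R]_(1 + d)) :
  0 < b -> tau != 0 -> 0 <= N -> N * normal_pdf 0 1 b = b ->
  let u := \col_k (A k 0 / tau) in
  (N%:E * gam R (1 + d) [set t | (~` orthant (threshold b x)) (affmap 0 A t)] =
   \int[@leb R \x gam R d]_z
     (weight `|tau|^-1 (b ^+ 2 * (tau ^- 2 - 1)) (tau ^- 2) (tau ^- 2 / (2 * b ^+ 2)) z.1 *
      \1_(exceed x (\col_k (b ^+ 2 * (u k 0 - 1))) u (b *: rsubmx A)) z)%:E)%E.
Proof.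
move=> b0 tau0 N0 Nb u.
set C := [set t | _].
have mC : measurable C.
  apply: measurable_affmap_preimage; apply: measurableC; exact: measurable_orthant.
have mphi : measurable_fun [set: R] (normal_pdf (0 : R) 1) by exact: measurable_normal_pdf.
have mi : measurable_fun setT (fun t => (\1_C t)%:E : \bar R).
  exact/measurable_EFinP/measurable_indic.
have i0 t : (0 <= (\1_C t)%:E :> \bar R)%E by rewrite lee_fin.
have -> : gam R (1 + d) C = (\int[gam R d.+1]_t (\1_C t)%:E)%E.
  by rewrite integral_indic// setIT.
rewrite ge0_integral_gamS//.
have mF := measurable_fun_fubini_tonelli_F (m2 := gam R d) _
  (measurableT_comp mi (@measurable_cons_pair R d)) (fun z => i0 _).
pose F y := (\int[gam R d]_t (\1_C (cons_pair (y, t)))%:E)%E.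
have F0 y : (0 <= F y)%E by exact: integral_ge0.
have -> : (\int[@stdnormal R]_x0 \int[gam R d]_t (\1_C (cons_pair (x0, t)))%:E)%E =
  (\int[@stdnormal R]_y F y)%E by [].
rewrite ge0_integral_stdnormal//.
have a0 : (b * tau)^-1 != 0 by rewrite invr_eq0 mulf_neq0// gt_eqF.
rewrite (ge0_integral_affine (b / tau) a0); first last.
- by move=> y; rewrite mule_ge0// lee_fin normal_pdf_ge0.
- by apply: emeasurable_funM => //; exact/measurable_EFinP.
rewrite muleA -EFinM -ge0_integralZl//; first last.
- by rewrite lee_fin mulr_ge0.
- by move=> y _; rewrite mule_ge0// lee_fin normal_pdf_ge0.
- have maff := @measurable_affine R (b * tau)^-1 (b / tau).
  apply: emeasurable_funM; first exact: (measurableT_comp mF maff).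
  by apply/measurable_EFinP; exact: (measurableT_comp mphi maff).
have mw := @measurable_weight R `|tau|^-1 (b ^+ 2 * (tau ^- 2 - 1)) (tau ^- 2) (tau ^- 2 / (2 * b ^+ 2)).
have w0 s : 0 <= weight `|tau|^-1 (b ^+ 2 * (tau ^- 2 - 1)) (tau ^- 2) (tau ^- 2 / (2 * b ^+ 2)) s.
  by rewrite mulr_ge0 ?expR_ge0.
rewrite fubini_tonelli1; first last.
- by move=> z; rewrite lee_fin mulr_ge0.
- apply/measurable_EFinP; apply: measurable_funM; first exact: (measurableT_comp mw measurable_fst).
  by apply: measurable_indic; exact: measurable_exceed.
apply: eq_integral => s _; rewrite /fubini_F.
under [RHS]eq_integral do rewrite EFinM /=.
rewrite ge0_integralZl//; first last.
- by rewrite lee_fin.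
- apply/measurable_EFinP.
  have mp : measurable_fun [set: d.-tuple R] (fun t => (s, t)) by exact: measurable_fun_pair.
  set E := exceed _ _ _ _; have mE : measurable E by exact: measurable_exceed.
  exact: (measurableT_comp (measurable_indic mE) mp).
rewrite [X in (_ * X)%E = _]muleC muleA -EFinM; congr (_%:E * _)%E.
  have pk0 : normal_peak (1 : R) != 0 by rewrite gt_eqF// normal_peak_gt0// oner_eq0.
  (* The equation b = N phi(b) solved for N phi(0). It absorbs [N], and its factor [b] cancels the
     Jacobian 1 / (b |tau|). *)
  have Npk : N * normal_peak 1 = b * expR (b ^+ 2 / 2).
    have := congr1 (fun y => y * expR (b ^+ 2 / 2)) Nb; rewrite normal_pdf01E => <-.
    rewrite -!mulrA -expRD (_ : _ + _ = 0) ?expR0 ?mulr1//.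
    by field.
  rewrite normal_pdf01E mulrACA Npk normfV normrM (gtr0_norm b0) invfM.
  rewrite [LHS](_ : _ = `|tau|^-1 *
    (expR (b ^+ 2 / 2) * expR (- ((b * tau)^-1 * s + b / tau) ^+ 2 / 2))); last first.
    by field; rewrite normr_eq0 tau0 gt_eqF.
  rewrite -expRD; congr (_ * expR _); field.
  by rewrite tau0 gt_eqF.
apply: eq_integral => t _; congr EFin; rewrite !indicE; congr (nat_of_bool _)%:R.
(* Multiplying the comparison by [b] and removing b^2 from both sides turns the threshold b + x_k /
   b into x_k and the coordinate into [level]. *)
have key k : (threshold b x k 0 < tnth (affmap 0 A (cons_pair ((b * tau)^-1 * s + b / tau, t))) k) =
   (x k 0 < level (\col_k (b ^+ 2 * (u k 0 - 1))) u (b *: rsubmx A) (s, t) k).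
  rewrite tnth_affmap big_ord_recl /level !mxE add0r tnth0.
  rewrite -(ltr_pM2l b0) -subr_gt0 -[RHS]subr_gt0; congr (0 < _).
  under eq_bigr do rewrite tnthS.
  under [in RHS]eq_bigr do rewrite !mxE -mulrA.
  rewrite -mulr_sumr.
  rewrite (eq_bigr (fun j => A k (lift ord0 j) * tnth t j)) => [|//] /=.
  have -> : \sum_(i < d) A k (lift ord0 i) * tnth t i = \sum_i A k (rshift 1 i) * tnth t i.
    by apply: eq_bigr => i _; congr (A k _ * _); exact/val_inj.
  have -> : A k ord0 = A k 0 by congr (A k _); exact/val_inj.
  by field; rewrite tau0 gt_eqF.
apply/idP/idP; rewrite !inE /=.
  move=> h; apply: contrapT => nE; apply: h => k; rewrite mxE leNgt key.
  by apply/negP => hk; apply: nE; exists k.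
by move=> [k]; rewrite -key => hk /(_ k); rewrite mxE leNgt hk.
Qed.

End row_probability.

(** * Limits of drift, slope and residual covariance *)

Section row_limits.
Variables (R : realType) (d : nat).
Local Notation dn := ((1 + d)%:R : R).

Definition rowmean (M : 'M[R]_(1 + d)) (i : 'I_(1 + d)) : R := dn^-1 * \sum_j M i j.
Definition allmean (M : 'M[R]_(1 + d)) : R := dn^-1 * \sum_i rowmean M i.

Let dn0 : dn != 0. Proof. by rewrite pnatr_eq0. Qed.

Section algebra.
Variables (A : 'M[R]_(1 + d)) (b c : R).
Hypotheses (b0 : b != 0).
Hypothesis axis : A^T *m const_mx 1 = col_mx c%:M 0 :> 'cV[R]_(1 + d).
Let D := \matrix_(i, j) (b ^+ 2 * (1 - (A *m A^T) i j)).
(** The mean of the coordinates of A t is tau t_0, so |tau| is its standard deviation and [u i] is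
    the regression coefficient of component i on it. *)
Let tau := c / dn.
Let u i := A i 0 / tau.

(** Summing a row of A A^T applies [A] to A^T 1, which is c times the first basis vector. Averages
    of the covariance thus see only the first column of [A]. *)
Lemma axis_rowsum i : \sum_j (A *m A^T) i j = c * A i 0.
Proof.
have : (A *m (A^T *m (const_mx 1 : 'cV[R]_(1 + d)))) i 0 = \sum_j (A *m A^T) i j.
  by rewrite mulmxA mxE; apply: eq_bigr => j _; rewrite [const_mx _ _ _]mxE mulr1.
move=> <-; rewrite axis mxE (big_ord_recl (0 + d)) big1 ?addr0.
  rewrite mxE; case: splitP => [j _|j]; last by [].
  by rewrite mxE ord1 eqxx mulr1n mulrC; congr (_ * A i _); exact/val_inj.
move=> j _; rewrite mxE; case: splitP => [k /=|k _]; last by rewrite mxE mulr0.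
by case: k => -[].
Qed.

Lemma axis_colsum : \sum_i A i 0 = c.
Proof.
have /colP/(_ 0) := axis; rewrite mxE => h.
transitivity ((col_mx c%:M 0 : 'cV[R]_(1 + d)) 0 0).
  by rewrite -h; apply: eq_bigr => j _; rewrite !mxE mulr1.
rewrite mxE; case: splitP => [j _|j]; last by [].
by rewrite mxE ord1 eqxx mulr1n.
Qed.

Lemma axis_rowmean i : rowmean D i = b ^+ 2 * (1 - tau * A i 0).
Proof.
rewrite /rowmean; under eq_bigr do rewrite mxE.
rewrite -mulr_sumr sumrB axis_rowsum sumr_const card_ord /tau.
rewrite -[1 *+ _]/dn; by field.
Qed.

Lemma axis_allmean : allmean D = b ^+ 2 * (1 - tau ^+ 2).
Proof.
rewrite /allmean; under eq_bigr do rewrite axis_rowmean.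
rewrite -mulr_sumr sumrB -mulr_sumr axis_colsum sumr_const card_ord /tau.
rewrite -[1 *+ _]/dn; by field.
Qed.

Hypothesis tau0 : tau != 0.

Lemma axis_drift i : b ^+ 2 * (u i - 1) = (allmean D - rowmean D i) / tau ^+ 2.
Proof. by rewrite axis_allmean axis_rowmean /u; field. Qed.

(** Dropping the first column of [A] subtracts A_i0 A_j0 = tau^2 u_i u_j from the covariance, which
    leaves the covariance of the residuals given the mean. *)
Lemma axis_gram i j : ((b *: rsubmx A) *m (b *: rsubmx A)^T) i j =
  b ^+ 2 - D i j - b ^+ 2 * tau ^+ 2 * u i * u j.
Proof.
pose T := \sum_k A i (rshift 1 k) * A j (rshift 1 k).
have Dij : D i j = b ^+ 2 - b ^+ 2 * (A i 0 * A j 0 + T).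
  rewrite mxE mulrBr mulr1; congr (_ - _ * _).
  rewrite mxE (big_ord_recl (0 + d)) mxE; congr (A i _ * A j _ + _).
  apply: eq_bigr => k _; rewrite mxE; congr (A i _ * A j _); exact/val_inj.
have Bij : ((b *: rsubmx A) *m (b *: rsubmx A)^T) i j = b ^+ 2 * T.
  rewrite mxE mulr_sumr; apply: eq_bigr => k _; rewrite !mxE; ring.
by rewrite Bij Dij /u; field.
Qed.

End algebra.

Variables (b c : nat -> R) (A : nat -> 'M[R]_(1 + d)) (Gamma : 'M[R]_(1 + d)).
Hypothesis b_gt0 : forall n, 0 < b n.
Hypothesis b_inv : (b n)^-1 @[n --> \oo] --> (0 : R).
Hypothesis axis : forall n, (A n)^T *m const_mx 1 = col_mx (c n)%:M 0 :> 'cV[R]_(1 + d).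
Let D n := \matrix_(i, j) (b n ^+ 2 * (1 - (A n *m (A n)^T) i j)).
Hypothesis D_cvg : forall i j, D n i j @[n --> \oo] --> Gamma i j / 2.
Let tau n := c n / dn.
Let u n i := A n i 0 / tau n.
Let Gh := 2^-1 *: Gamma.

Let b0 n : b n != 0. Proof. by rewrite gt_eqF. Qed.

Let rowmean_cvg i : rowmean (D n) i @[n --> \oo] --> rowmean Gh i.
Proof.
apply: cvgMl_tmp; apply: cvg_sumr => j; rewrite [Gh _ _]mxE mulrC; exact: D_cvg.
Qed.

Let allmean_cvg : allmean (D n) @[n --> \oo] --> allmean Gh.
Proof. by apply: cvgMl_tmp; apply: cvg_sumr => i; exact: rowmean_cvg. Qed.

Let binv2 : (b n)^-1 ^+ 2 @[n --> \oo] --> (0 : R).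
Proof. by rewrite -(mulr0 (0 : R)); exact: (cvgM b_inv b_inv). Qed.

Lemma tau2_cvg : tau n ^+ 2 @[n --> \oo] --> (1 : R).
Proof.
have -> : (fun n => tau n ^+ 2) = (fun n => 1 - allmean (D n) * (b n)^-1 ^+ 2).
  by apply/funext => n; rewrite (axis_allmean _ (axis n)) -/(tau n); field.
rewrite -[X in _ --> X]subr0 -(mulr0 (allmean Gh)).
apply: cvgB; [exact: cvg_cst|exact: cvgM].
Qed.

Lemma tau_neq0 : \forall n \near \oo, tau n != 0.
Proof.
apply: filterS (cvgr_gt _ tau2_cvg 0 ltr01) => n.
by apply: contraTneq => ->; rewrite expr0n ltxx.
Qed.

Lemma tauV2_cvg : tau n ^- 2 @[n --> \oo] --> (1 : R).
Proof. by rewrite -[X in _ --> X]invr1; apply: cvgV => //; exact: tau2_cvg. Qed.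

Lemma norm_tauV_cvg : `|tau n|^-1 @[n --> \oo] --> (1 : R).
Proof.
rewrite -[X in _ --> X]invr1; apply: cvgV => //.
have -> : (fun n => `|tau n|) = (fun n => Num.sqrt (tau n ^+ 2)).
  by apply/funext => n; rewrite sqrtr_sqr.
rewrite -(sqrtr1 R); apply: (continuous_cvg _ (@sqrt_continuous R _)).
exact: tau2_cvg.
Qed.

(** This limit is the [w] of the limiting weight. By [axis_allmean] the expression is the overall
    mean of [D n] divided by tau^2. *)
Lemma tail_shift_cvg : b n ^+ 2 * (tau n ^- 2 - 1) @[n --> \oo] --> allmean Gh.
Proof.
have h : allmean (D n) * tau n ^- 2 @[n --> \oo] --> allmean Gh.
  by rewrite -[X in _ --> X]mulr1; apply: cvgM => //; exact: tauV2_cvg.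
apply: cvg_trans h; apply: near_eq_cvg; near=> n.
have t0 : tau n != 0 by near: n; exact: tau_neq0.
by rewrite (axis_allmean _ (axis n)) -/(tau n); field.
Unshelve. all: by end_near. Qed.

Lemma quadratic_cvg : tau n ^- 2 / (2 * b n ^+ 2) @[n --> \oo] --> (0 : R).
Proof.
have -> : (fun n => tau n ^- 2 / (2 * b n ^+ 2)) = (fun n => tau n ^- 2 * 2^-1 * (b n)^-1 ^+ 2).
  by apply/funext => n; rewrite (invfM 2 (b n ^+ 2)) mulrA exprVn.
rewrite -(mulr0 (1 * 2^-1 : R)); apply: cvgM => //.
by apply: cvgMr_tmp; exact: tauV2_cvg.
Qed.

Lemma drift_cvg i : b n ^+ 2 * (u n i - 1) @[n --> \oo] --> allmean Gh - rowmean Gh i.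
Proof.
have h : (allmean (D n) - rowmean (D n) i) * tau n ^- 2 @[n --> \oo]
    --> allmean Gh - rowmean Gh i.
  rewrite -[X in _ --> X]mulr1; apply: cvgM; last exact: tauV2_cvg.
  by apply: cvgB; [exact: allmean_cvg|exact: rowmean_cvg].
apply: cvg_trans h; apply: near_eq_cvg; near=> n.
have t0 : tau n != 0 by near: n; exact: tau_neq0.
by rewrite (axis_drift _ (axis n) t0).
Unshelve. all: by end_near. Qed.

Lemma slope_cvg i : u n i @[n --> \oo] --> (1 : R).
Proof.
have -> : (fun n => u n i) = (fun n => 1 + b n ^+ 2 * (u n i - 1) * (b n)^-1 ^+ 2).
  by apply/funext => n; field; rewrite b0.
rewrite -[X in _ --> X]addr0 -(mulr0 (allmean Gh - rowmean Gh i)).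
apply: cvgD; first exact: cvg_cst.
by apply: cvgM => //; exact: drift_cvg.
Qed.

(** The terms of order b^2 cancel. With u_k = 1 + v_k / b^2, the difference b^2 - b^2 tau^2 u_i u_j
    is b^2 (1 - tau^2) - tau^2 (v_i + v_j) - tau^2 v_i v_j / b^2, and b^2 (1 - tau^2) is the overall
    mean of [D n]. *)
Lemma gram_cvg i j :
  ((b n *: rsubmx (A n)) *m (b n *: rsubmx (A n))^T) i j @[n --> \oo]
  --> rowmean Gh i + rowmean Gh j - allmean Gh - Gamma i j / 2.
Proof.
pose v n k := b n ^+ 2 * (u n k - 1).
have h : allmean (D n) - tau n ^+ 2 * (v n i + v n j) - tau n ^+ 2 * (v n i * v n j * (b n)^-1 ^+ 2)
     - D n i j @[n --> \oo]
  --> allmean Gh - 1 * ((allmean Gh - rowmean Gh i) + (allmean Gh - rowmean Gh j)) -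
    1 * ((allmean Gh - rowmean Gh i) * (allmean Gh - rowmean Gh j) * 0) - Gamma i j / 2.
  apply: cvgB => //; apply: cvgB.
    apply: cvgB => //; apply: cvgM; first exact: tau2_cvg.
    by apply: cvgD; exact: drift_cvg.
  apply: cvgM; first exact: tau2_cvg.
  by apply: cvgM => //; apply: cvgM; exact: drift_cvg.
rewrite (_ : rowmean Gh i + _ - _ - _ = allmean Gh - 1 * ((allmean Gh - rowmean Gh i) + (allmean Gh - rowmean Gh j)) -
    1 * ((allmean Gh - rowmean Gh i) * (allmean Gh - rowmean Gh j) * 0) - Gamma i j / 2); last by ring.
apply: cvg_trans h; apply: near_eq_cvg; near=> n.
have t0 : tau n != 0 by near: n; exact: tau_neq0.
rewrite (axis_gram _ _ t0) -/(D n) (axis_allmean _ (axis n)) -/(tau n) /v -/(u n i) -/(u n j).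
by field.
Unshelve. all: by end_near. Qed.

End row_limits.

(** * Coordinates of the profile mean and covariance *)

Section profile_parameters.
Variables (R : realType) (d : nat) (Gamma : 'M[R]_(1 + d)).
Hypotheses (sym : forall i j, Gamma i j = Gamma j i) (diag0 : forall i, Gamma i i = 0).
Let Gh := 2^-1 *: Gamma.

(** Double centering written out; symmetry of [Gamma] turns the column means into row means. *)
Lemma profile_covE i j : profile_cov Gamma i j =
  rowmean Gh i + rowmean Gh j - allmean Gh - Gamma i j / 2.
Proof.
pose a : R := (1 + d)%:R^-1; pose J : 'M[R]_(1 + d) := const_mx 1.
have cE : centering R (1 + d) = 1%:M - a *: J.
  rewrite /centering; congr (_ - _ *: _); apply/matrixP => k l.
  by rewrite !mxE big_ord1 !mxE mulr1.
have JG k l : (J *m Gamma) k l = \sum_m Gamma l m.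
  by rewrite mxE; apply: eq_bigr => m _; rewrite mxE mul1r sym.
have GJ k l : (Gamma *m J) k l = \sum_m Gamma k m.
  by rewrite mxE; apply: eq_bigr => m _; rewrite mxE mulr1.
have JGJ k l : (J *m Gamma *m J) k l = \sum_m \sum_n Gamma m n.
  by rewrite mxE; apply: eq_bigr => m _; rewrite JG mxE mulr1.
have rowE k : rowmean Gh k = 2^-1 * (a * \sum_m Gamma k m).
  rewrite /rowmean mulrCA; congr (_ * _); rewrite mulr_sumr.
  by apply: eq_bigr => m _; rewrite mxE.
have allE : allmean Gh = 2^-1 * (a * (a * \sum_m \sum_n Gamma m n)).
  rewrite /allmean -/a; under eq_bigr do rewrite rowE mulrA.
  by rewrite -mulr_sumr; ring.
have -> : profile_cov Gamma = - 2^-1 *: (Gamma - a *: (J *m Gamma) -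
    (a *: (Gamma *m J) - a *: (a *: (J *m Gamma *m J)))).
  rewrite /profile_cov cE; congr (_ *: _).
  rewrite mulmxBl mul1mx -scalemxAl mulmxBr mulmx1 -scalemxAr mulmxBl -scalemxAl.
  by rewrite scalerBr.
have entry (M N P Q : 'M[R]_(1 + d)) : (- 2^-1 *: (M - a *: N - (a *: P - a *: (a *: Q)))) i j =
    - 2^-1 * (M i j - a * N i j - (a * P i j - a * (a * Q i j))).
  by rewrite !mxE.
by rewrite entry JG GJ JGJ !rowE allE; field.
Qed.

(** With zero diagonal in [Gamma], Sigma_kk is twice the k-th row mean minus the overall mean, and
    these entries average to the overall mean. *)
Lemma profile_meanE k : profile_mean (profile_cov Gamma) k 0 = allmean Gh - rowmean Gh k.
Proof.
have meanE (S : 'M[R]_(1 + d)) : profile_mean S k 0 =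
    - 2^-1 * (S k k - (1 + d)%:R^-1 * \sum_i S i i).
  rewrite /profile_mean /vmean !mxE mulr1; congr (_ * (_ - _ * _)).
  by apply: eq_bigr => i _; rewrite mxE.
have sumE : \sum_i rowmean Gh i = (1 + d)%:R * allmean Gh.
  by rewrite /allmean mulrA divff ?mul1r// pnatr_eq0.
rewrite meanE profile_covE diag0.
rewrite (eq_bigr (fun i => 2 * rowmean Gh i - allmean Gh)); last first.
  by move=> i _; rewrite profile_covE diag0; field.
rewrite sumrB -mulr_sumr sumE sumr_const card_ord -(mulr_natl (allmean Gh)).
have : ((1 + d)%:R : R) != 0 by rewrite pnatr_eq0.
by move: ((1 + d)%:R : R) => N N0; field.
Qed.

End profile_parameters.

(** * The limit distribution as a Poisson-type exponential *)

Section husler_reiss_limit.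
Variable R : realType.

Lemma maximum_le_threshold d m (X : 'I_m.+1 -> d.-tuple R) (b : R) (x : 'cV[R]_d) :
  0 < b ->
  le_vec (b *: (comp_max X - b *: ones R d)) x <-> forall i, orthant (threshold b x) (X i).
Proof.
move=> b0.
have E k : ((b *: (comp_max X - b *: ones R d)) k 0 <= x k 0) =
    (\big[Num.max/tnth (X ord0) k]_(i < m.+1) tnth (X i) k <= b + x k 0 / b).
  by rewrite !mxE mulr1 -ler_pdivlMl// lerBlDl mulrC.
split => h.
  by move=> i k; rewrite !mxE; have := h k; rewrite E => /bigmax_leP[_]; apply.
move=> k; rewrite E; apply/bigmax_leP; split=> [|i _]; first by have := h ord0 k; rewrite !mxE.
by have := h i k; rewrite !mxE.
Qed.

Lemma row_maximum_law d m (dO : measure_display) (Om : measurableType dO)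
    (P : probability Om R) (X : 'I_m.+1 -> {RV P >-> d.-tuple R}) (A : 'M[R]_d)
    (b : R) (x : 'cV[R]_d) :
  0 < b -> mutually_independent X -> (forall i, gaussian 0 (A *m A^T) (X i)) ->
  fine (P [set w | le_vec (b *: (comp_max (fun i => X i w) - b *: ones R d)) x]) =
  (1 - fine (gam R d [set t | (~` orthant (threshold b x)) (affmap 0 A t)])) ^+ m.+1.
Proof.
move=> b0 iX gX.
have mO : measurable (orthant (threshold b x)) by exact: measurable_orthant.
have -> : [set w | le_vec (b *: (comp_max (fun i => X i w) - b *: ones R d)) x] =
    [set w | forall i, orthant (threshold b x) (X i w)].
  by apply/seteqP; split => w /=; rewrite maximum_le_threshold.
rewrite (iX (fun=> orthant (threshold b x)))//.
pose C := [set t | orthant (threshold b x) (affmap 0 A t)].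
have mC : measurable C by exact: measurable_affmap_preimage.
rewrite (eq_bigr (fun=> (fine (gam R d C))%:E)); last first.
  move=> i _; rewrite -[LHS]/(distribution P (X i) _) (gaussian_law (gX i) (erefl _))//.
  by rewrite fineK ?fin_num_measure.
rewrite prodEFin /= prodr_const card_ord; congr (_ ^+ _).
rewrite -[X in _ = 1 - fine (gam R d X)]/(~` C) probability_setC//.
by rewrite fineB ?fin_num_measure//= opprB addrC subrK.
Qed.

(** As log n / b_n^2 tends to 1/2, replacing log n by b_n^2 doubles the limit. *)
Lemma normalized_gram_cvg (s : nat -> R) (b : nat -> R) (g : R) :
  (forall n, (0 < n)%N -> b n = n%:R * normal_pdf 0 1 (b n)) ->
  ln m.+1%:R * (1 - s m) @[m --> \oo] --> g / 4 ->
  b m.+1 ^+ 2 * (1 - s m) @[m --> \oo] --> g / 2.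
Proof.
move=> hb hs.
have hlog := normalizer_log hb.
have half0 : (2^-1 : R) != 0 by rewrite invr_neq0.
have h : (ln m.+1%:R * (1 - s m)) * (ln m.+1%:R / b m.+1 ^+ 2)^-1 @[m --> \oo] --> g / 4 * 2^-1^-1.
  by apply: cvgM => //; apply: cvgV.
rewrite (_ : g / 2 = g / 4 * 2^-1^-1); last by field.
apply: cvg_trans h; apply: near_eq_cvg; near=> m.
have b0 : 0 < b m.+1 by exact: normalizer_gt0.
(* The first row has sample size 1 and ln 1 = 0, so it is excluded before dividing. *)
have ln0 : 0 < ln (m.+1%:R : R).
  by rewrite ln_gt0// ltr1n ltnS; near: m; exists 1%N.
by rewrite /=; field; rewrite !gt_eqF.
Unshelve. all: by end_near. Qed.

Lemma cvg_seq_unique (u : nat -> R) (l l' : R) :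
  u n @[n --> \oo] --> l -> u n @[n --> \oo] --> l' -> l = l'.
Proof.
move=> ul ul'.
by rewrite -(cvg_lim (@norm_hausdorff _ R) ul) -(cvg_lim (@norm_hausdorff _ R) ul').
Qed.

Lemma cvg_bounded_fun (u : nat -> R) (l : R) : u n @[n --> \oo] --> l -> bounded_fun u.
Proof. by move=> ul; apply: cvg_seq_bounded; apply/cvg_ex; exists l. Qed.

Lemma bounded_fun_le (u : nat -> R) (M : R) : (forall n, `|u n| <= M) -> bounded_fun u.
Proof.
move=> h; exists M; split; first exact: num_real.
by move=> y My n _; apply: le_trans (h n) (ltW My).
Qed.

Lemma husler_reiss_limit d (Gamma : 'M[R]_(1 + d)) (G : 'cV[R]_(1 + d) -> R) :
  husler_reiss Gamma G ->
  exists (w : R) (B : 'M[R]_(1 + d, d)), B *m B^T = profile_cov Gamma /\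
  forall x,
    let f := fun z => (weight 1 w 1 0 z.1 *
      \1_(exceed x (profile_mean (profile_cov Gamma)) (const_mx 1) B) z)%:E in
    (@leb R \x gam R d)%E.-integrable setT f /\
    G x = expR (- fine (\int[@leb R \x gam R d]_z f z)%E).
Proof.
move=> [_ [dO [Om [P [X [S [b [hX [hS _] hD hb hG]]]]]]]].
have /choice[Ac hAc] : forall m, exists Ac : 'M[R]_(1 + d) * R, Ac.1 *m Ac.1^T = S m /\
    Ac.1^T *m const_mx 1 = col_mx Ac.2%:M 0 :> 'cV[R]_(1 + d).
  move=> m; have [_ /(_ ord0)[A0 [A0S _]]] := hX m.
  have [A' A'A [c hc]] := axis_factor (A0 : 'M[R]_(1 + d)).
  by exists (A', c); rewrite /= A'A.
pose A m := (Ac m).1; pose c m := (Ac m).2; pose bb m := b m.+1.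
have AS m : A m *m (A m)^T = S m by have [] := hAc m.
have axis m : (A m)^T *m const_mx 1 = col_mx (c m)%:M 0 :> 'cV[R]_(1 + d) by have [] := hAc m.
have bb0 m : 0 < bb m by exact: (normalizer_gt0 hb).
have bbinv : (bb m)^-1 @[m --> \oo] --> (0 : R) by exact: (normalizer_inv_cvg hb).
have DG i j : bb m ^+ 2 * (1 - S m i j) @[m --> \oo] --> Gamma i j / 2.
  exact: (normalized_gram_cvg hb (hD i j)).
have D_cvg i j : (\matrix_(i, j) (bb m ^+ 2 * (1 - (A m *m (A m)^T) i j))) i j
    @[m --> \oo] --> Gamma i j / 2.
  by under eq_fun do rewrite mxE AS; exact: DG.
have half (y z : R) : y / 2 = z / 2 -> y = z.
  by move=> /(congr1 (fun t => t * 2)); rewrite !divfK// pnatr_eq0.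
(* Symmetry and the zero diagonal of [Gamma] are read off from the covariances S_m, which are
   symmetric with unit diagonal. *)
have sym i j : Gamma i j = Gamma j i.
  apply: half; apply: (cvg_seq_unique (DG i j)).
  rewrite (_ : (fun m => _) = (fun m => bb m ^+ 2 * (1 - S m j i))); first exact: DG.
  apply/funext => m; congr (_ * (1 - _)); rewrite -AS.
  by rewrite !mxE; apply: eq_bigr => k _; rewrite !mxE mulrC.
have diag0 i : Gamma i i = 0.
  apply: half; rewrite mul0r; apply: (cvg_seq_unique (DG i i)).
  by under eq_fun do rewrite hS subrr mulr0; exact: cvg_cst.
pose Bm m := bb m *: rsubmx (A m).
have gram i j : (Bm m *m (Bm m)^T) i j @[m --> \oo] --> profile_cov Gamma i j.
  rewrite profile_covE//; exact: (gram_cvg bb0 bbinv axis D_cvg).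
(* The square of an entry is at most the diagonal Gram entry of its row, which converges. The bound
   M' is at least 1, so M' <= M'^2 and it bounds the entry itself. *)
have Bbound (ij : 'I_(1 + d) * 'I_d) : bounded_fun (fun m => Bm m ij.1 ij.2).
  have [M [_ hM]] := cvg_bounded_fun (gram ij.1 ij.1).
  pose M' := Num.max M 0 + 1.
  apply: (@bounded_fun_le _ M') => m.
  have MM' : M < M' by rewrite /M' ltr_pwDr// le_max lexx.
  have M'1 : 1 <= M' by rewrite /M' lerDr le_max lexx orbT.
  have := hM _ MM' m I => /(le_trans (ler_norm _)).
  rewrite mxE (bigD1 ij.2)//= [(Bm m)^T _ _]mxE => h.
  have sq : Bm m ij.1 ij.2 ^+ 2 <= M'.
    apply: le_trans h; rewrite expr2 lerDl sumr_ge0// => k _.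
    by rewrite [(Bm m)^T _ _]mxE -expr2 sqr_ge0.
  rewrite -ler_sqr ?nnegrE// ?(le_trans _ M'1)//.
  rewrite real_normK ?num_real//; apply: le_trans sq _.
  by rewrite ler_eXnr.
(* The subsequence is extracted before [x] is introduced, so one factor [B] serves every [x]. *)
have [f fi fB] := cvg_subseq_finite Bbound.
have foo := increasing_seq_cvg_infty fi.
pose B : 'M[R]_(1 + d, d) := \matrix_(i, j) limn ((fun m => Bm m i j) \o f).
have Bf i j : Bm (f n) i j @[n --> \oo] --> B i j.
  by rewrite mxE; exact: (fB (i, j)).
have sub (u : nat -> R) (l : R) : u m @[m --> \oo] --> l -> u (f n) @[n --> \oo] --> l.
  by move=> ul; exact: (cvg_comp _ _ foo ul).
exists (allmean (2^-1 *: Gamma)), B; split.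
  apply/matrixP => i j; apply/esym; apply: (cvg_seq_unique (sub _ _ (gram i j))).
  rewrite mxE; under eq_fun do rewrite mxE.
  apply: cvg_sumr => k; rewrite [B^T _ _]mxE; apply: cvgM; first exact: Bf.
  by under eq_fun do rewrite mxE; exact: Bf.
move=> x F.
pose tau m := c m / (1 + d)%:R.
pose u m := \col_k (A m k 0 / tau m).
have mu_cvg k : (\col_k (bb (f n) ^+ 2 * (u (f n) k 0 - 1))) k 0 @[n --> \oo] -->
    profile_mean (profile_cov Gamma) k 0.
  rewrite profile_meanE//; under eq_fun do rewrite !mxE.
  exact: (sub _ _ (drift_cvg (i := k) bb0 bbinv axis D_cvg)).
have u_cvg k : u (f n) k 0 @[n --> \oo] --> (1 : R).
  under eq_fun do rewrite mxE.
  exact: (sub _ _ (slope_cvg bb0 bbinv axis D_cvg k)).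
have r0 n : 0 <= `|tau (f n)|^-1 by rewrite invr_ge0.
have e0 n : 0 <= tau (f n) ^- 2 / (2 * bb (f n) ^+ 2).
  by apply: divr_ge0; [rewrite invr_ge0 sqr_ge0|rewrite mulr_ge0// sqr_ge0].
have [iF cF] := exceed_dct x
  (sub _ _ (norm_tauV_cvg bb0 bbinv axis D_cvg))
  (sub _ _ (tail_shift_cvg bb0 bbinv axis D_cvg))
  (sub _ _ (tauV2_cvg bb0 bbinv axis D_cvg))
  (sub _ _ (quadratic_cvg bb0 bbinv axis D_cvg))
  r0 e0 mu_cvg u_cvg Bf.
split=> //.
pose p n := fine (gam R (1 + d) [set t | (~` orthant (threshold (bb (f n)) x)) (affmap 0 (A (f n)) t)]).
have mC n : measurable [set t | (~` orthant (threshold (bb (f n)) x)) (affmap 0 (A (f n)) t)].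
  by apply: measurable_affmap_preimage; apply: measurableC; exact: measurable_orthant.
have p01 n : 0 <= p n <= 1.
  rewrite fine_ge0//= -lee_fin fineK ?fin_num_measure//; exact: probability_le1.
have Np : (f n).+1%:R * p n @[n --> \oo] --> fine (\int[@leb R \x gam R d]_z F z)%E.
  have h := cF; rewrite -[X in _ --> X]fineK in h; last exact: integrable_fin_num.
  apply: cvg_trans (fine_cvg h); apply: near_eq_cvg; near=> n.
  have t0 : tau (f n) != 0.
    by near: n; exact: (foo _ (tau_neq0 bb0 bbinv axis D_cvg)).
  rewrite /= -(row_probability (A (f n)) x (bb0 (f n)) t0 (ler0n _ (f n).+1)).
    by rewrite fineM ?fin_num_measure.
  exact: (esym (hb (f n).+1 isT)).
have Noo : ((f n).+1%:R : R) @[n --> \oo] --> +oo.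
  apply/cvgryPge => M; near=> n.
  apply: (@le_trans _ _ (f n)%:R); last by rewrite ler_nat.
  by near: n; apply: (foo [set k | M <= k%:R]); exact: nbhs_infty_ger.
apply: (cvg_seq_unique (u := fun n => (1 - p n) ^+ (f n).+1)); last exact: cvg_expR_power.
have := sub _ _ (hG x); apply: cvg_trans; apply: near_eq_cvg; apply: nearW => n.
have [iX gX] := hX (f n).
rewrite (row_maximum_law (A := A (f n)) x (bb0 (f n)) iX)// => i.
by rewrite AS.
Unshelve. all: by end_near.
Qed.

End husler_reiss_limit.

(** * Generalized Pareto law and profile *)

Section tail_measure.
Variables (R : realType) (p d : nat) (w : R) (mu : 'cV[R]_p) (B : 'M[R]_(p, d)).

Definition position (z : R * d.-tuple R) : p.-tuple R :=
  affmap (mu + const_mx z.1) B z.2.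

Lemma tnth_position z k : tnth (position z) k = level mu (const_mx 1) B z k.
Proof. by rewrite tnth_affmap /level !mxE mul1r. Qed.

Lemma measurable_position : measurable_fun setT position.
Proof.
apply/measurable_fun_tnthP => k.
rewrite (_ : _ \o _ = fun z => level mu (const_mx 1) B z k).
  exact: measurable_level.
by apply/funext => z /=; rewrite tnth_position.
Qed.

Lemma measurable_position_preimage C : measurable C -> measurable (position @^-1` C).
Proof. by move=> mC; rewrite -[X in measurable X]setTI; exact: measurable_position. Qed.

Lemma exceed_position x : exceed x mu (const_mx 1) B = position @^-1` (~` orthant x).
Proof.
apply/seteqP; split => z /=.
  by move=> [k xk] /(_ k); rewrite mxE tnth_position leNgt xk.
move=> h; apply: contrapT => nz; apply: h => k; rewrite mxE tnth_position leNgt.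
by apply/negP => xk; apply: nz; exists k.
Qed.

Local Notation density := (fun z => (weight 1 w 1 0 z.1)%:E : \bar R).

Lemma weight1_ge0 (s : R) : 0 <= weight 1 w 1 0 s.
Proof. by rewrite mulr_ge0 ?expR_ge0. Qed.

Lemma measurable_density (D : set (R * d.-tuple R)) : measurable_fun D density.
Proof.
apply: measurable_funTS; apply/measurable_EFinP.
by apply: (measurableT_comp (measurable_weight 1 w 1 0)).
Qed.

(** The exponent measure of the limit law, cut down to the complement of the lower orthant at 0: the
    density exp(- s) has infinite mass near minus infinity. *)
Definition tail_measure (C : set (p.-tuple R)) : \bar R :=
  (\int[@leb R \x gam R d]_(z in position @^-1` (C `&` ~` orthant 0)) density z)%E.

Let tail0 : tail_measure set0 = 0%E.
Proof. by rewrite /tail_measure set0I preimage_set0 integral_set0. Qed.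

Let tail_ge0 C : (0 <= tail_measure C)%E.
Proof. by apply: integral_ge0 => z _; rewrite lee_fin weight1_ge0. Qed.

Let tail_sigma_additive : semi_sigma_additive tail_measure.
Proof.
move=> F mF tF mUF; rewrite /tail_measure setI_bigcupl preimage_bigcup.
rewrite ge0_integral_bigcup//.
- apply: is_cvg_ereal_nneg_natsum_cond => n _ _; exact: tail_ge0.
- move=> n; apply: measurable_position_preimage; apply: measurableI => //.
  by apply: measurableC; exact: measurable_orthant.
- exact: measurable_density.
- by move=> z _; rewrite lee_fin weight1_ge0.
- apply/trivIsetP => i j _ _ ij; rewrite -preimage_setI setIACA.
  by move/trivIsetP : tF => /(_ i j I I ij) ->; rewrite set0I preimage_set0.
Qed.

HB.instance Definition _ := isMeasure.Build _ _ _ tail_measure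
  tail0 tail_ge0 tail_sigma_additive.

End tail_measure.

Section tail_law.
Variables (R : realType) (p d : nat) (w : R) (mu : 'cV[R]_p) (B : 'M[R]_(p, d)).
Local Notation density := (fun z : R * d.-tuple R => (weight 1 w 1 0 z.1)%:E : \bar R).
Local Notation tail := (tail_measure w mu B).
Let pos := position mu B.
Let lam x := (\int[@leb R \x gam R d]_z
  (weight 1 w 1 0 z.1 * \1_(exceed x mu (const_mx 1) B) z)%:E)%E.

Lemma lamE x : lam x = (\int[@leb R \x gam R d]_(z in pos @^-1` (~` orthant x)) density z)%E.
Proof.
rewrite [RHS]integral_mkcond; apply: eq_integral => z _.
rewrite patchE indicE exceed_position; case: ifPn => _; by rewrite ?mulr1 ?mulr0.
Qed.

(** Not being below min(z, 0) means either not being below z, or being below z but not below 0. The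
    difference is thus the numerator of the generalized Pareto distribution function. *)
Lemma tail_orthant (z : 'cV[R]_p) :
  lam (map_mx (fun t => Num.min t 0) z) = (lam z + tail (orthant z))%E.
Proof.
rewrite !lamE /tail_measure -ge0_integral_setU//.
- congr (integral _ _ _); rewrite -preimage_setU; congr (_ @^-1` _).
  apply/seteqP; split => t /=.
    move=> h; case: (pselect (orthant z t)) => zt; [right|by left].
    split=> // h0; apply: h => k; rewrite !mxE le_min.
    by have := zt k; have := h0 k; rewrite !mxE => -> ->.
  move=> h hm; case: h => [|[_]]; apply => k; have := hm k; rewrite !mxE le_min => /andP[]//.
- apply: measurable_position_preimage; apply: measurableC; exact: measurable_orthant.
- apply: measurable_position_preimage; apply: measurableI; first exact: measurable_orthant.
  apply: measurableC; exact: measurable_orthant.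
- exact: measurable_density.
- by move=> t _; rewrite lee_fin weight1_ge0.
- apply/disj_setPS => t [/= h [h' _]]; exact: h.
Qed.

Lemma gen_pareto_law (G : 'cV[R]_p -> R)
    (dZ : measure_display) (OmZ : measurableType dZ) (PZ : probability OmZ R)
    (Z : {RV PZ >-> p.-tuple R}) :
  gen_pareto G Z ->
  (forall x, (@leb R \x gam R d)%E.-integrable setT (fun z =>
      (weight 1 w 1 0 z.1 * \1_(exceed x mu (const_mx 1) B) z)%:E)) ->
  (forall x, G x = expR (- fine (lam x))) ->
  exists2 L : R, 0 < L & forall C, measurable C ->
    tail C = (L%:E * distribution PZ Z C)%E.
Proof.
move=> hZ il GE.
have lamf x : lam x \is a fin_num by apply: integrable_fin_num.
pose L := fine (lam 0).
have L0 : 0 <= L.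
  apply: fine_ge0; apply: integral_ge0 => z _.
  by rewrite lee_fin mulr_ge0 ?weight1_ge0.
have law z : distribution PZ Z (orthant z) =
    ((fine (lam (map_mx (fun t => Num.min t 0) z)) - fine (lam z)) / L)%:E.
  rewrite /distribution /pushforward [X in PZ X](_ : _ = [set w | le_vec (col_of_tuple (Z w)) z])//.
  rewrite hZ !GE !expRK; congr EFin.
  by rewrite opprK invrN mulrN -mulNr opprD opprK.
(* Division by 0 yields 0, so L = 0 would make the distribution function of [Z] vanish identically,
   against total mass 1. *)
have Lgt0 : 0 < L.
  rewrite lt_neqAle L0 andbT eq_sym; apply/eqP => Leq0.
  have : distribution PZ Z setT = 0%E.
    apply: (@orthant_unique R p (distribution PZ Z) mzero) => // [z|].
      by rewrite [LHS]law Leq0 invr0 mulr0.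
    by rewrite [X in (X < _)%E](@probability_setT _ _ R (distribution PZ Z)) ltry.
  by rewrite probability_setT => /eqP; rewrite onee_eq0.
exists L => // C mC.
pose m : {measure set (p.-tuple R) -> \bar R} := mscale (NngNum L0) (distribution PZ Z).
rewrite -[RHS]/(m C); apply/esym.
apply: (@orthant_unique R p m [the measure _ _ of tail]) mC => [z|].
  rewrite /m /= /mscale /= law -EFinM mulrC divfK ?gt_eqF//.
  by rewrite EFinB !fineK// tail_orthant addeAC subee// add0e.
by rewrite /m /= /mscale /= probability_setT mule1 ltry.
Qed.

End tail_law.

(** * Centering and the conditional law *)

Section centered.
Variables (R : realType) (d : nat).

Definition centered (t : d.-tuple R) : d.-tuple R :=
  tuple_of_col (col_of_tuple t - vmean (col_of_tuple t) *: ones R d).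

Lemma centeringE (v : 'cV[R]_d) : centering R d *m v = v - vmean v *: ones R d.
Proof.
rewrite /centering mulmxBl mul1mx -scalemxAl -mulmxA; congr (_ - _).
rewrite /vmean -scalerA; congr (_ *: _); apply/colP => k.
rewrite !mxE big_ord1 !mxE mul1r mulr1; apply: eq_bigr => j _.
by rewrite !mxE mul1r.
Qed.

Lemma measurable_centered : measurable_fun setT centered.
Proof.
rewrite (_ : centered = affmap 0 (centering R d)); first exact: measurable_affmap.
by apply/funext => t; rewrite /affmap add0r centeringE.
Qed.

End centered.

Section profile_law.
Variables (R : realType) (p d : nat) (w : R) (mu : 'cV[R]_p) (B : 'M[R]_(p, d)).
Hypotheses (p0 : (0 < p)%N) (mu0 : \sum_k mu k 0 = 0)
  (B0 : forall j, \sum_k B k j = 0).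
Local Notation tail := (tail_measure w mu B).
Let pos := position mu B.

Definition nonneg_sum : set (p.-tuple R) := [set t | 0 <= \sum_k tnth t k].

Lemma measurable_nonneg_sum : measurable nonneg_sum.
Proof.
have mS : measurable_fun setT (fun t : p.-tuple R => \sum_k tnth t k).
  by apply: measurable_sum => k; exact: measurable_tnth.
rewrite (_ : nonneg_sum = (fun t : p.-tuple R => \sum_k tnth t k) @^-1` `[0, +oo[).
  by rewrite -[X in measurable X]setTI; exact: mS.
by apply/seteqP; split => t; rewrite /nonneg_sum /= in_itv/= andbT.
Qed.

Lemma sum_position z : \sum_k tnth (pos z) k = p%:R * z.1.
Proof.
under eq_bigr do rewrite tnth_affmap.
rewrite big_split /= [X in _ + X]exchange_big /= [X in _ + X]big1 ?addr0.
  under eq_bigr do rewrite !mxE.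
  by rewrite big_split /= mu0 add0r sumr_const card_ord mulr_natl.
by move=> j _; rewrite -mulr_suml B0 mul0r.
Qed.

Lemma centered_position z : centered (pos z) = affmap mu B z.2.
Proof.
rewrite /centered /affmap.
have -> : vmean (col_of_tuple (pos z)) = z.1.
  rewrite /vmean; under eq_bigr do rewrite mxE.
  by rewrite sum_position mulKf// pnatr_eq0 -lt0n.
congr tuple_of_col; rewrite tuple_of_colK; apply/colP => k; rewrite !mxE; ring.
Qed.

Lemma integral_weight_nonneg :
  (\int[@leb R]_s (weight 1 w 1 0 s * \1_`[0%R, +oo[ s)%:E = (expR (- w / 2))%:E)%E.
Proof.
rewrite (eq_integral (fun s => (expR (- w / 2))%:E * (exponential_pdf 1 s)%:E)%E); last first.
  move=> s _; rewrite -EFinM; congr EFin; rewrite indicE mem_setE in_itv/= andbT.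
  case: (leP 0 s) => s0; last by rewrite mulr0 lt0_exponential_pdf ?mulr0.
  rewrite exponential_pdfE// /weight mulr1 !mul1r -expRD; congr expR; ring.
have mpdf : measurable_fun [set: R] (fun s : R => (exponential_pdf 1 s)%:E : \bar R).
  by apply/measurable_EFinP; exact: measurable_exponential_pdf.
have pdf0 (s : R) : (0 <= (exponential_pdf 1 s)%:E :> \bar R)%E.
  by rewrite lee_fin exponential_pdf_ge0.
rewrite ge0_integralZl//.
by rewrite integral_leb// integral_exponential_pdf// mule1.
Qed.

(** For s > 0 the coordinates have positive sum, so the position is never below 0 and the cut at the
    orthant has no effect. The integrand then factors: s contributes the exponential mass, t the law
    of mu + B Y. *)
Lemma tail_profile (C : set (p.-tuple R)) : measurable C ->
  tail (@centered R p @^-1` C `&` nonneg_sum) =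
  ((expR (- w / 2))%:E * gam R d [set t | C (affmap mu B t)])%E.
Proof.
move=> mC.
pose C' := [set t | C (affmap mu B t)].
have mC' : measurable C' by exact: measurable_affmap_preimage.
set D := pos @^-1` ((@centered R p @^-1` C `&` nonneg_sum) `&` ~` orthant 0).
have mD : measurable D.
  apply: measurable_position_preimage; apply: measurableI.
    apply: measurableI; last exact: measurable_nonneg_sum.
    by rewrite -[X in measurable X]setTI; exact: measurable_centered.
  by apply: measurableC; exact: measurable_orthant.
have mw : measurable_fun [set: R] (weight 1 w 1 0) by exact: measurable_weight.
pose g (z : R * d.-tuple R) : \bar R := (weight 1 w 1 0 z.1 * \1_D z)%:E.
have mg : measurable_fun setT g.
  apply/measurable_EFinP; apply: measurable_funM; last exact: measurable_indic.
  exact: (measurableT_comp mw measurable_fst).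
have g0 z : (0 <= g z)%E by rewrite lee_fin mulr_ge0 ?weight1_ge0.
transitivity (\int[@leb R \x gam R d]_z g z)%E.
  rewrite /tail_measure integral_mkcond; apply: eq_integral => z _.
  by rewrite patchE /g indicE -/D; case: ifPn => _; rewrite ?mulr1 ?mulr0.
rewrite fubini_tonelli1//.
(* At s = 0 the sum vanishes and the position may equal 0, which lies in the removed orthant; the
   identity is claimed off this null set. *)
have inner s : s != 0 -> fubini_F (gam R d) g s =
    ((weight 1 w 1 0 s * \1_`[0%R, +oo[ s)%:E * gam R d C')%E.
  move=> s0; rewrite /fubini_F.
  rewrite (eq_integral (fun t => (weight 1 w 1 0 s * \1_`[0%R, +oo[ s)%:E * (\1_C' t)%:E)%E).
    rewrite ge0_integralZl//; last 2 first.
    - exact/measurable_EFinP/measurable_indic.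
    - by rewrite lee_fin mulr_ge0 ?weight1_ge0.
    by rewrite integral_indic// setIT.
  move=> t _; rewrite /g -EFinM -(mulrA (weight 1 w 1 0 s)) /=.
  apply: (congr1 (fun y => (weight 1 w 1 0 s * y)%:E)).
  rewrite !indicE -natrM mulnb; congr (nat_of_bool _)%:R.
  rewrite mem_setE in_itv/= andbT.
  have DE : D (s, t) <-> 0 <= s /\ C (affmap mu B t).
    rewrite /D /= /nonneg_sum /= centered_position sum_position /=.
    rewrite pmulr_rge0 ?ltr0n//; split => [[[]]//|[s_ge0 Ct]].
    split=> // h0.
    have : p%:R * s <= 0.
      rewrite -(sum_position (s, t)); apply: sumr_le0 => k _.
      by have := h0 k; rewrite !mxE.
    by apply/negP; rewrite -ltNge mulr_gt0 ?ltr0n// lt_neqAle eq_sym s0.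
  by apply/idP/andP; rewrite !inE => /DE.
have mh : measurable_fun [set: R]
    (fun s => (weight 1 w 1 0 s * \1_`[0%R, +oo[ s)%:E : \bar R).
  by apply/measurable_EFinP; apply: measurable_funM => //; exact: measurable_indic.
have h0 (s : R) : (0 <= (weight 1 w 1 0 s * \1_`[0%R, +oo[ s)%:E :> \bar R)%E.
  by rewrite lee_fin mulr_ge0 ?weight1_ge0.
rewrite -integral_weight_nonneg -ge0_integralZr//.
apply: ae_eq_integral => //.
- exact: (measurable_fun_fubini_tonelli_F (m2 := gam R d) g mg g0).
- exact: emeasurable_funM.
have null0 : (@leb R).-negligible [set 0].
  by exists [set 0]; split => //; exact: lebesgue_measure_set1.
apply: (negligibleS _ null0) => s /= h.
by apply: contrapT => /eqP s0; apply: h => _; exact: inner.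
Qed.

End profile_law.

(** * Centered factors and identification of the profile *)

Section final.
Variable R : realType.

Lemma sum_profile_mean d (S : 'M[R]_d) : (0 < d)%N -> \sum_k profile_mean S k 0 = 0.
Proof.
move=> d0; have dn0 : (d%:R : R) != 0 by rewrite pnatr_eq0 -lt0n.
under eq_bigr do rewrite mxE.
rewrite -mulr_sumr -[X in _ * X](_ : \sum_k (mdiag S k 0 - vmean (mdiag S)) = _); last first.
  by apply: eq_bigr => k _; rewrite !mxE mulr1.
by rewrite sumrB sumr_const card_ord -[vmean _ *+ _]mulr_natl /vmean mulVKf// subrr mulr0.
Qed.

(** For r = 1^T B the scalar r r^T is 1^T Sigma 1, which is 0 because centering annihilates 1; a
    vanishing sum of squares forces r = 0. *)
Lemma profile_cov_factor_colsum d q (Gamma : 'M[R]_d) (B : 'M[R]_(d, q)) : (0 < d)%N ->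
  B *m B^T = profile_cov Gamma -> forall j, \sum_k B k j = 0.
Proof.
move=> d0 BB j; have dn0 : (d%:R : R) != 0 by rewrite pnatr_eq0 -lt0n.
have c1 : centering R d *m ones R d = 0.
  rewrite centeringE; have -> : vmean (ones R d) = 1; last by rewrite scale1r subrr.
  by rewrite /vmean; under eq_bigr do rewrite mxE; rewrite sumr_const card_ord mulVf.
pose r := (ones R d)^T *m B.
have rE k : r 0 k = \sum_i B i k.
  by rewrite mxE; apply: eq_bigr => i _; rewrite !mxE mul1r.
have rr : (r *m r^T) 0 0 = 0.
  rewrite /r trmx_mul trmxK mulmxA -(mulmxA _ B) BB /profile_cov -scalemxAr -scalemxAl.
  by rewrite -!mulmxA c1 !mulmx0 scaler0 mxE.
rewrite -rE; apply/eqP; rewrite -sqrf_eq0; apply/eqP.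
have : \sum_k r 0 k ^+ 2 = 0.
  by rewrite -[RHS]rr mxE; apply: eq_bigr => k _; rewrite [r^T _ _]mxE expr2.
by move/psumr_eq0P; apply => // k _; exact: sqr_ge0.
Qed.

(** [gaussian] asks for a square factor, while [B] has one column fewer than rows: a zero column is
    added, and the extra normal variable integrates out. *)
Lemma gam_row_mx0 p d (v : 'cV[R]_p) (B : 'M[R]_(p, d)) (C : set (p.-tuple R)) :
  measurable C ->
  gam R (1 + d) [set t | C (affmap v (row_mx 0 B : 'M[R]_(p, 1 + d)) t)] =
  gam R d [set t | C (affmap v B t)].
Proof.
move=> mC.
have m1 := measurable_affmap_preimage v (row_mx 0 B : 'M[R]_(p, 1 + d)) mC.
have m2 := measurable_affmap_preimage v B mC.
transitivity (\int[gam R d.+1]_t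
   (\1_[set t | C (affmap v (row_mx 0 B : 'M[R]_(p, 1 + d)) t)] t)%:E)%E.
  by rewrite integral_indic// setIT.
rewrite ge0_integral_gamS; last 2 first.
- by apply/measurable_EFinP; exact: measurable_indic.
- by move=> t; rewrite lee_fin.
rewrite (eq_integral (fun=> gam R d [set t | C (affmap v B t)])).
  by rewrite integral_cst// [X in (_ * X)%E](@probability_setT _ _ R (@stdnormal R)) mule1.
move=> x _; transitivity (\int[gam R d]_t (\1_[set t | C (affmap v B t)] t)%:E)%E; last first.
  by rewrite integral_indic// setIT.
apply: eq_integral => t _; congr EFin; rewrite !indicE; congr (nat_of_bool _)%:R.
by apply/idP/idP; rewrite !inE /= /affmap col_of_tuple_cons
  (mul_row_col (0 : 'M[R]_(p, 1))) mul0mx add0r.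
Qed.

End final.

Theorem proposition5p1 (R : realType) (d : nat) (hd : (0 < d)%N)
    (Gamma : 'M[R]_d) (G : 'cV[R]_d -> R) (hG : husler_reiss Gamma G)
    (dZ : measure_display) (OmZ : measurableType dZ) (PZ : probability OmZ R)
    (Z : {RV PZ >-> d.-tuple R}) (hZ : gen_pareto G Z)
    (dU : measure_display) (OmU : measurableType dU) (PU : probability OmU R)
    (U : {RV PU >-> d.-tuple R}) (hU : profile Z U) :
  gaussian (profile_mean (profile_cov Gamma)) (profile_cov Gamma) U.
Proof.
case: d hd Gamma G hG Z hZ U hU => // d hd Gamma G hG Z hZ U hU.
have [w [B [BB hB]]] := @husler_reiss_limit R d Gamma G hG.
set mu := profile_mean (profile_cov Gamma).
have mu0 : \sum_k mu k 0 = 0 by exact: sum_profile_mean.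
have B0 : forall j, \sum_k B k j = 0 by exact: profile_cov_factor_colsum BB.
have [L L0 tailE] := gen_pareto_law hZ (fun x => (hB x).1) (fun x => (hB x).2).
have tailP := tail_profile w hd mu0 B0.
have -> : profile_cov Gamma = (row_mx 0 B : 'M[R]_(1 + d)) *m (row_mx 0 B)^T.
  by rewrite -BB tr_row_mx (mul_row_col (0 : 'M[R]_(1 + d, 1))) mul0mx add0r.
rewrite -/mu; apply: gaussian_of_gam => C mC.
rewrite gam_row_mx0//.
case: hU => dS [OmS [PS [Zs [hZs ->//]]]].
pose gC := gam R d [set t | C (affmap mu B t)].
have mCc : measurable (@centered R d.+1 @^-1` C).
  by rewrite -[X in measurable X]setTI; exact: measurable_centered.
have mN := @measurable_nonneg_sum R d.+1.
have K0 : expR (- w / 2) != 0 :> R by rewrite gt_eqF// expR_gt0.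
(* The constant K / L is the same for every [D]. The choice D = setT gives the probability of the
   conditioning event, so the constant cancels in the quotient. *)
have distE (D : set (d.+1.-tuple R)) : measurable D ->
    fine (distribution PZ Z (@centered R d.+1 @^-1` D `&` @nonneg_sum R d.+1)) =
    expR (- w / 2) / L * fine (gam R d [set t | D (affmap mu B t)]).
  move=> mD.
  have mDN : measurable (@centered R d.+1 @^-1` D `&` @nonneg_sum R d.+1).
    by apply: measurableI => //; rewrite -[X in measurable X]setTI; exact: measurable_centered.
  have mDg : measurable [set t | D (affmap mu B t)] by exact: measurable_affmap_preimage.
  have := congr1 fine (tailE _ mDN); rewrite tailP// !fineM ?fin_num_measure//= => h.
  by rewrite mulrAC h mulrAC divff ?mul1r// gt_eqF.
transitivity (distribution PS Zs (@centered R d.+1 @^-1` C)) => //.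
rewrite hZs//.
rewrite -[X in fine X / _]/(distribution PZ Z (@centered R d.+1 @^-1` C `&` @nonneg_sum R d.+1)).
rewrite -[X in _ / fine X]/(distribution PZ Z (@nonneg_sum R d.+1)).
rewrite -[@nonneg_sum R d.+1 in X in _ / X]setTI.
rewrite distE// (distE setT)// probability_setT /= mulr1 mulrAC divff ?mul1r.
  by rewrite fineK ?fin_num_measure//; exact: measurable_affmap_preimage.
by rewrite mulf_neq0// invr_eq0 gt_eqF.
Qed.
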